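(* Let $\nu$ be a (signed) measure on $\mathbf{R}^d$, $d\ge2$, such that $\|\nu\|_{H^{-1}}<\infty$, and assume that there exists a compact set $K\subset\mathbf{R}^d$, whose boundary has $C^2$ regularity, such that $\nu$ is nonpositive or nonnegative outside of $K$. Then there exist a compact set $K_1$ which contains $K$, and a constant $c>0$, such that $$\|\nu\|_{H^{-1}}\ge c\,\big\|\nu|_{K_1}\big\|_{H^{-1}(K_1)}.$$ Furthermore, $c$ and $K_1$ depend only on $K$ (and not on $\nu$).
   Context: For a measure $\mu$ on $\mathbf{R}^d$, $\|\mu\|_{H^{-1}}=\sup_{f\in C_0^\infty(\mathbf{R}^d),\,f\neq 0}\frac{\int f\,d\mu}{\|\nabla f\|_{L^2}}$, where $C_0^\infty$ denotes smooth compactly supported functions. For a bounded open set $\Omega$ and a measure $\mu$ on $\Omega$, $\|\mu\|_{H^{-1}(\Omega)}=\sup_{f\in H^1(\Omega),\,f\ne0}\frac{\int f\,d\mu}{\|f\|_{H^1}}$, where $\|f\|_{H^1}^2=\|f\|_{L^2}^2+\|\nabla f\|_{L^2}^2$. The same definition is used with the compact set $K_1$ in place of $\Omega$ for measures on $K_1$. $\nu|_{K_1}$ is the restriction of $\nu$ to $K_1$. *)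

(* Defs.v *)
From HB Require Import structures.
From mathcomp Require Import all_boot all_order all_algebra.
From mathcomp Require Import all_classical all_reals all_analysis.
From mathcomp Require Import measurable_realfun.

Set Implicit Arguments.
Unset Strict Implicit.
Unset Printing Implicit Defensive.

Import Order.TTheory GRing.Theory Num.Theory.
Import numFieldNormedType.Exports.

Local Open Scope classical_set_scope.
Local Open Scope ring_scope.

(* 'rV[R]_d with its Borel sigma-algebra. *)
Notation borel_rV R d := (g_sigma_algebraType (@open 'rV[R]_d)).

Section borel.
Context {R : realType}.

Lemma open_borel d (A : set 'rV[R]_d) :
  open A -> measurable (A : set (borel_rV R d)).
Proof. by move=> oA; apply: sub_sigma_algebra. Qed.

Lemma closed_borel d (A : set 'rV[R]_d) :
  closed A -> measurable (A : set (borel_rV R d)).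
Proof.
by move=> /closed_openC/open_borel/measurableC; rewrite setCK.
Qed.

Lemma compact_borel d (A : set 'rV[R]_d) :
  compact A -> measurable (A : set (borel_rV R d)).
Proof. by move=> cA; apply: closed_borel; exact: compact_closed cA. Qed.

Lemma measurable_coord d (i : 'I_d) :
  measurable_fun [set: borel_rV R d] (fun x : borel_rV R d => (x : 'rV[R]_d) 0 i).
Proof.
apply: (measurability _ (RGenOpens.measurableE R)).
move=> _ [_ [a [b ->] <-]]; rewrite setTI; apply: open_borel.
have /continuousP := @coord_continuous R 1 d 0 i.
by apply; exact: interval_open.
Qed.

Let box d (q : 'rV[rat]_d * 'rV[rat]_d) : set 'rV[R]_d :=
  [set x | forall i, ratr (q.1 0 i) < x 0 i < ratr (q.2 0 i)].

Let open_bigcup_box d (U : set 'rV[R]_d) : open U ->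
  U = \bigcup_(q in [set q | box q `<=` U]) box q.
Proof.
move=> oU; apply/seteqP; split => [x Ux|x [q qU]]; last exact: qU.
have /nbhs_ballP[e /= e0 xeU] : nbhs x U by exact: open_nbhs_nbhs.
have H (i : 'I_d) : exists q : rat * rat,
    x 0 i - e < ratr q.1 < x 0 i /\ x 0 i < ratr q.2 < x 0 i + e.
  have /rat_in_itvoo[p] : x 0 i - e < x 0 i by rewrite ltrBlDr ltrDl.
  rewrite in_itv/= => hp.
  have /rat_in_itvoo[q] : x 0 i < x 0 i + e by rewrite ltrDl.
  by rewrite in_itv/= => hq; exists (p, q).
have [f hf] := choice H.
exists (\row_i (f i).1, \row_i (f i).2) => [y /= yf|/= i].
  apply: xeU; split => // j i; rewrite ord1.
  have := yf i; rewrite !mxE => /andP[y1 y2].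
  have [/andP[f1 f2] /andP[f3 f4]] := hf i.
  rewrite /ball/= ltr_norml; apply/andP; split.
    by rewrite ltrBrDr addrC ltrBlDr addrC (lt_trans y2)// addrC.
  by rewrite ltrBlDr addrC -ltrBlDr (lt_trans f1).
rewrite !mxE.
by have [/andP[f1 f2] /andP[f3 f4]] := hf i; rewrite f2 f3.
Qed.

Lemma measurable_fun_rV d (T : measurableType d) n (f : T -> borel_rV R n) :
  (forall i, measurable_fun [set: T] (fun t => (f t : 'rV[R]_n) 0 i)) ->
  measurable_fun [set: T] f.
Proof.
move=> mf; apply: (@measurability d _ T (borel_rV R n) setT f (@open 'rV[R]_n) erefl).
move=> _ [U oU <-]; rewrite setTI (open_bigcup_box oU) preimage_bigcup.
rewrite bigcup_mkcond; apply: countable_bigcupT_measurable => [|q].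
  exact: countableP.
case: ifPn => // _.
rewrite (_ : _ @^-1` _ = \bigcap_(i in [set: 'I_n])
  ((fun t => (f t : 'rV[R]_n) 0 i) @^-1` `]ratr (q.1 0 i), ratr (q.2 0 i)[)).
  apply: fin_bigcap_measurable => // i _.
  by rewrite -[X in measurable X]setTI; apply: mf.
apply/seteqP; split => [t + i _|t + i]; rewrite /= ?in_itv/=; first exact.
by move=> /(_ i I); rewrite /= in_itv.
Qed.

End borel.

Section lebesgue.
Context {R : realType}.

Definition cons_rV d (x : measurableTypeR R * borel_rV R d) : borel_rV R d.+1 :=
  \row_i oapp ((x.2 : 'rV_d) 0) x.1 (unlift ord0 i).

Lemma measurable_cons_rV d : measurable_fun setT (@cons_rV d).
Proof.
apply: measurable_fun_rV => i; under eq_fun do rewrite mxE.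
case: unliftP => [j _|_] /=; last exact: measurable_fst.
exact: (measurableT_comp (measurable_coord j) measurable_snd).
Qed.

Let uncons_rV d (y : borel_rV R d.+1) : measurableTypeR R * borel_rV R d :=
  ((y : 'rV_d.+1) 0 ord0, \row_i (y : 'rV_d.+1) 0 (lift ord0 i)).

Let cons_rVK d : cancel (@cons_rV d) (@uncons_rV d).
Proof.
move=> [x y]; rewrite /uncons_rV /cons_rV/= mxE unlift_none/=; congr pair.
by apply/rowP => i; rewrite !mxE liftK.
Qed.

Let measurable_uncons_rV d : measurable_fun setT (@uncons_rV d).
Proof.
apply: measurable_fun_pair => /=; first exact: measurable_coord.
apply: measurable_fun_rV => i; under eq_fun do rewrite mxE.
exact: measurable_coord.
Qed.

Section step.
Variables (d : nat) (mu : {sigma_finite_measure set (borel_rV R d) -> \bar R}).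

Definition lebesgue_cons : set (borel_rV R d.+1) -> \bar R :=
  pushforward (@lebesgue_measure R \x mu)%E (@cons_rV d).

HB.instance Definition _ := Measure.copy lebesgue_cons
  (@measure_function_pushforward__canonical__measure_function_Measure _ _ _ _ _
    (@lebesgue_measure R \x mu)%E _ (@measurable_cons_rV d)).

Let lebesgue_cons_sigma_finite : sigma_finite setT lebesgue_cons.
Proof.
have /sigma_finiteP[F [FT ndF Foo]] := sigma_finiteT (@lebesgue_measure R).
have /sigma_finiteP[G [GT ndG Goo]] := sigma_finiteT mu.
have FGT : setT = \bigcup_n (F n `*` G n).
  apply/esym; rewrite -subTset => -[x y] _.
  have [n _ Fnx] : (\bigcup_n F n) x by rewrite -FT.
  have [k _ Gky] : (\bigcup_n G n) y by rewrite -GT.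
  exists (maxn n k) => //; split => /=.
    by move: x Fnx; exact/subsetPset/ndF/leq_maxl.
  by move: y Gky; exact/subsetPset/ndG/leq_maxr.
exists (fun n => @uncons_rV d @^-1` (F n `*` G n)) => [|n].
  by rewrite -preimage_bigcup -FGT preimage_setT.
have [mF Fn] := Foo n; have [mG Gn] := Goo n; split.
  rewrite -[X in measurable X]setTI; apply: measurable_uncons_rV => //.
  exact: measurableX.
rewrite /lebesgue_cons /pushforward -comp_preimage.
rewrite (_ : _ \o _ = id); last by apply/funext => x; exact: cons_rVK.
by rewrite preimage_id product_measure1E// lte_mul_pinfty// ge0_fin_numE.
Qed.

HB.instance Definition _ := Measure_isSigmaFinite.Build _ _ _ lebesgue_cons
  lebesgue_cons_sigma_finite.

End step.

(* Lebesgue measure on R^d, as the d-fold product of the one on R. *)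
Fixpoint lebesgue_rV d : {sigma_finite_measure set (borel_rV R d) -> \bar R} :=
  if d is d'.+1 then lebesgue_cons (lebesgue_rV d')
  else @dirac _ (borel_rV R 0) (0 : 'rV[R]_0) R.

End lebesgue.

Section calculus.
Context {R : realType}.

Definition partial d (i : 'I_d) (f : 'rV[R]_d -> R) : 'rV[R]_d -> R :=
  'D_(delta_mx 0 i) f.

Definition iter_partial d (s : seq 'I_d) (f : 'rV[R]_d -> R) : 'rV[R]_d -> R :=
  foldr (@partial d) f s.

(* [derive] is total, hence the separate existence clause. *)
Definition Ck d (k : nat) (f : 'rV[R]_d -> R) :=
  (forall s, (size s < k)%N ->
     forall i x, derivable (iter_partial s f) x (delta_mx 0 i)) /\
  (forall s, (size s <= k)%N -> continuous (iter_partial s f)).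

Definition test_fun d (U : set 'rV[R]_d) (f : 'rV[R]_d -> R) :=
  [/\ forall k, Ck k f, compact (closure [set x | f x != 0]) &
      closure [set x | f x != 0] `<=` U].

(* Near each boundary point, up to the choice of a coordinate axis i and of its
   orientation b, K is the closed epigraph of a C^2 function of the other d - 1
   coordinates. *)
Definition C2_boundary d (K : set 'rV[R]_d) :=
  forall x, (closure K `\` K°) x ->
    exists (i : 'I_d) (b : bool) (g : 'rV[R]_d.-1 -> R), Ck 2 g /\
      \forall y \near x, K y <-> g (col' i y) <= (-1) ^+ b * y 0 i.

End calculus.

(* Signed Radon measures, possibly of infinite total variation: differences
   spos - sneg of two positive Borel measures that are finite on compact sets
   (not required to be mutually singular; everything below depends only on
   the difference). *)
Record smeasure (R : realType) (d : nat) := Smeasure {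
  spos : {measure set (borel_rV R d) -> \bar R} ;
  sneg : {measure set (borel_rV R d) -> \bar R} ;
  spos_lty : forall C : set 'rV[R]_d, compact C -> (spos C < +oo)%E ;
  sneg_lty : forall C : set 'rV[R]_d, compact C -> (sneg C < +oo)%E }.

Section smeasure.
Context {R : realType} {d : nat}.
Implicit Types (nu : smeasure R d) (D : set 'rV[R]_d) (f : 'rV[R]_d -> R).

Let mrestr_lty (mu : {measure set (borel_rV R d) -> \bar R})
    (D : set (borel_rV R d)) (mD : measurable D) :
  (forall C : set 'rV[R]_d, compact C -> (mu C < +oo)%E) ->
  forall C : set 'rV[R]_d, compact C -> (mrestr mu mD C < +oo)%E.
Proof.
move=> muoo C cC; apply: le_lt_trans (muoo _ cC).
have mC := compact_borel cC.
by apply: le_measure; rewrite ?inE//; exact: measurableI.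
Qed.

Definition srestr nu (D : set (borel_rV R d)) (mD : measurable D) :=
  Smeasure (mrestr_lty mD (@spos_lty _ _ nu)) (mrestr_lty mD (@sneg_lty _ _ nu)).

Definition sintegral nu D f : R :=
  \int[spos nu]_(x in D) f x - \int[sneg nu]_(x in D) f x.

Definition nonneg_on nu D := forall B : set (borel_rV R d),
  measurable B -> B `<=` D -> (sneg nu B <= spos nu B)%E.

Definition nonpos_on nu D := forall B : set (borel_rV R d),
  measurable B -> B `<=` D -> (spos nu B <= sneg nu B)%E.

End smeasure.

Section Hm1.
Context {R : realType} {d : nat}.
Implicit Types (nu : smeasure R d) (U K : set 'rV[R]_d) (f : 'rV[R]_d -> R)
  (G : 'I_d -> 'rV[R]_d -> R).

Local Notation lambda := (@lebesgue_rV R d).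

Definition L2norm_grad f : R :=
  Num.sqrt (\int[lambda]_x \sum_i partial i f x ^+ 2).

Definition normHm1 nu : \bar R :=
  ereal_sup [set (sintegral nu setT f / L2norm_grad f)%:E |
    f in [set f | test_fun setT f /\ f <> cst 0]].

Definition L2 U f := measurable_fun (U : set (borel_rV R d)) f /\
  lambda.-integrable U (fun x => (f x ^+ 2)%:E).

Definition weak_partial U (i : 'I_d) f (g : 'rV[R]_d -> R) :=
  forall phi, test_fun U phi ->
    \int[lambda]_(x in U) (f x * partial i phi x) =
    - \int[lambda]_(x in U) (g x * phi x).

(* An element of H^1(U) is given with its weak gradient G, which it determines
   almost everywhere. *)
Definition H1 U f G :=
  [/\ L2 U f, forall i, L2 U (G i) & forall i, weak_partial U i f (G i)].

Definition H1norm U f G : R :=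
  Num.sqrt (\int[lambda]_(x in U) (f x ^+ 2) +
            \sum_i \int[lambda]_(x in U) (G i x ^+ 2)).

(* l is a value of the integral of f over K against nu. A measure may charge
   Lebesgue-null sets, where an element f of H^1 has no values; the integral is
   therefore extended from the functions of H^1 that are continuous on K, for
   which it makes sense, by H^1-convergence. The constant sequence gives back
   the integral of f when f is continuous on K. For compact K, the weak
   derivatives and the H^1 norm live on the interior of K. *)
Definition H1_pairing K nu f G (l : R) :=
  exists (f_ : nat -> 'rV[R]_d -> R) (G_ : nat -> 'I_d -> 'rV[R]_d -> R),
    [/\ forall n, {within K, continuous (f_ n)} /\ H1 K° (f_ n) (G_ n),
        H1norm K° (f_ n \- f) (fun i => G_ n i \- G i) @[n --> \oo] --> (0 : R) &
        sintegral nu K (f_ n) @[n --> \oo] --> l].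

(* [H1norm K° f G != 0] says that f is not the zero class of H^1. *)
Definition normHm1_on K nu : \bar R :=
  ereal_sup [set r | exists f G l, [/\ H1 K° f G, H1norm K° f G != 0,
    H1_pairing K nu f G l & r = (l / H1norm K° f G)%:E]].

End Hm1.

(* Main.v *)
Require Import Defs.
From mathcomp Require Import all_boot all_order all_algebra.
From mathcomp Require Import all_classical all_reals all_analysis.
From mathcomp Require Import measurable_realfun ring lra.

(* Take K1 = Q, a cube (a closed ball of the sup norm) containing K well inside, and
   write N for the norm of nu.  Split a function p on Q as eta p + (1 - eta) p with
   eta = 1 near K and eta = 0 near the boundary of Q.  The first piece is compactly
   supported, hence pairs with nu with size at most N |grad (eta p)|.  For the second,
   extend (1 - eta) p to w on R^d by reflection across the faces of Q and a cutoff; w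
   vanishes on K, off which nu has a sign, so the integral of w over Q is dominated by
   that of |w| over R^d, hence by N |grad w|, and reflection multiplies the H^1 norm by
   a dimensional constant only.

   Nonsmooth test functions such as |w| are handled through difference quotients: if v
   is Lipschitz with compact support and J_i bounds its one-sided difference quotients
   in the limit, the mollification rho * v satisfies |d_i (rho * v)| <= rho * J_i, and
   rho * J_i is bounded in L^2 by J_i.  A continuous f in H^1(Q) is replaced by the
   smooth p(x) = (rho * f)(a x) with a < 1, so that the mollifier only sees f inside Q. *)

Set Implicit Arguments.
Unset Strict Implicit.
Unset Printing Implicit Defensive.

Import Order.TTheory GRing.Theory Num.Theory.
Import numFieldNormedType.Exports.

Local Open Scope classical_set_scope.
Local Open Scope ring_scope.

(* all_analysis shadows this name with the integral of simple functions. *)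
Local Notation sintegral := Defs.sintegral.

(** * Lebesgue measure under affine maps *)

Section lebesgue_affine.
Context {R : realType}.
Local Notation mu := (@lebesgue_measure R).

(** If K lies in the cube of radius r, then Q has radius 3r: eta falls from 1 to 0 between r and 2r,
    and the outer cutoff from 1 to 0 between 3r and 4r, so that everything stays within radius 6r,
    where folding maps into Q. For a cube, reflection acts on each coordinate separately: it is
    piecewise a measure-preserving affine map, and it changes partial derivatives only by a sign.

    The number N controls gradients, whereas differentiating a cutoff leaves a term in p itself;
    this is where the full H^1 norm on Q comes in.

    The main obstacle is that nu may charge Lebesgue-null sets and that its mass on Q is not bounded
    in terms of N. Approximation in H^1 alone therefore says nothing about the pairing. Each
    approximation below has two separate properties: uniform closeness, whose error is multiplied by
    a finite mass and tends to 0 for fixed nu, and an energy bound by a constant multiple, uniform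
    along the approximation. No convergence of the energies is required. General elements of H^1 are
    reached last, by a limit in the inequality for continuous ones. *)

Lemma preimage_affine_itvoc (a b u v : R) : a != 0 ->
  exists I : interval R, (fun x => a * x + b) @^-1` `]u, v] = [set` I] /\
    (mu [set` I] = (`|a|^-1)%:E * mu `]u, v])%E.
Proof.
move=> a0; have [ap|an] : 0 < a \/ a < 0 by move: a0; rewrite neq_lt => /orP[]; [right|left].
- exists `](u - b) / a, (v - b) / a]; split.
    apply/seteqP; split => x /=; rewrite !in_itv/= ltr_pdivrMr// ler_pdivlMr//;
      by rewrite ltrBlDr lerBrDr (mulrC x).
  rewrite !lebesgue_measure_itv/= !lte_fin ltr_pM2r ?invr_gt0// ltrD2r.
  case: ifPn => uv; last by rewrite mule0.
  rewrite -!EFinB -EFinM gtr0_norm//; congr EFin; field; exact: lt0r_neq0.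
(* A negative slope moves the closed end to the left, which is why the statement only asserts that
   some interval exists. *)
- exists `[(v - b) / a, (u - b) / a[; split.
    apply/seteqP; split => x /=; rewrite !in_itv/= ltr_ndivlMr// ler_ndivrMr//;
      by rewrite ltrBlDr lerBrDr (mulrC x) andbC.
  rewrite !lebesgue_measure_itv/= !lte_fin ltr_nM2r ?invr_lt0// ltrD2r.
  case: ifPn => uv; last by rewrite mule0.
  rewrite -!EFinB -EFinM ltr0_norm//; congr EFin; field; exact: ltr0_neq0.
Qed.

Lemma measurable_affine (a b : R) :
  measurable_fun [set: measurableTypeR R] (fun x : measurableTypeR R => a * x + b : measurableTypeR R).
Proof. by apply: measurable_funD => //; apply: measurable_funM. Qed.

(** Uniqueness of Lebesgue measure: its pushforward by the affine map, scaled by |a|, has the right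
    value on half-open intervals. *)
Lemma ge0_integral_affine (h : measurableTypeR R -> \bar R) (a b : R) : a != 0 ->
  measurable_fun setT h -> (forall x, 0 <= h x)%E ->
  (\int[mu]_x h x = `|a|%:E * \int[mu]_x h (a * x + b)%R)%E.
Proof.
move=> a0 mh h0.
pose k := NngNum (normr_ge0 a).
pose nu := @measure_function_pushforward__canonical__measure_function_Measure
  _ _ _ (measurableTypeR R) R mu _ (measurable_affine a b).
rewrite (@eq_measure_integral _ _ _ setT (mscale k nu)); last first.
  move=> A mA _; apply: lebesgue_measure_unique => // _ [[u v] _ <-].
  have [I [eI muI]] := preimage_affine_itvoc b u v a0.
  have nuI : nu [set` `]u, v]] = mu [set` I] by rewrite -eI.
  rewrite -[RHS]/(`|a|%:E * nu [set` `]u, v]])%E nuI [X in (_ * X)%E]muI.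
  by rewrite muleA -EFinM mulfV ?normr_eq0// mul1e.
rewrite ge0_integral_mscale//; congr *%E.
rewrite ge0_integral_pushforward//.
exact: measurable_affine.
Qed.
End lebesgue_affine.

Section lebesgue_rV.
Context {R : realType}.
Local Notation lam d := (@lebesgue_rV R d).

Lemma ge0_integral_cons_rV d (h : borel_rV R d.+1 -> \bar R) :
  measurable_fun setT h -> (forall x, 0 <= h x)%E ->
  (\int[lam d.+1]_x h x =
   \int[lebesgue_measure]_x \int[lam d]_y h (cons_rV (x, y)))%E.
Proof.
move=> mh h0.
rewrite [LHS](@ge0_integral_pushforward _ _ _ _ _ (@cons_rV R d))//; last exact: measurable_cons_rV.
rewrite preimage_setT fubini_tonelli1//.
- by apply: measurableT_comp => //; exact: measurable_cons_rV.
- by move=> x; exact: h0.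
Qed.

Lemma integral_rV0 (h : borel_rV R 0 -> \bar R) : measurable_fun setT h ->
  (\int[lam 0]_x h x = h (0%R : 'rV[R]_0))%E.
Proof. by move=> mh; rewrite [LHS]integral_dirac// diracT mul1e. Qed.

Definition affine_rV d (a b : 'I_d -> R) (x : borel_rV R d) : borel_rV R d :=
  \row_i (a i * (x : 'rV_d) 0 i + b i).

Lemma measurable_affine_rV d (a b : 'I_d -> R) : measurable_fun setT (affine_rV a b).
Proof.
apply: measurable_fun_rV => i; under eq_fun do rewrite mxE.
apply: measurable_funD => //; apply: measurable_funM => //; exact: measurable_coord.
Qed.

Lemma affine_cons_rV d (a b : 'I_d.+1 -> R) x y :
  affine_rV a b (cons_rV (x, y)) = cons_rV (a ord0 * x + b ord0,
    affine_rV (a \o lift ord0) (b \o lift ord0) y).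
Proof.
apply/rowP => i; rewrite !mxE; case: (unliftP ord0 i) => [j ->|->]/=;
  by rewrite ?liftK ?unlift_none/= ?mxE.
Qed.

(** Tonelli reduces this to one variable at a time. Diagonal maps cover the translations, dilations
    and coordinate reflections, which are all the changes of variables below. *)
Lemma ge0_integral_affine_rV d (a b : 'I_d -> R) (h : borel_rV R d -> \bar R) :
  (forall i, a i != 0) -> measurable_fun setT h -> (forall x, 0 <= h x)%E ->
  (\int[lam d]_x h x = (\prod_i `|a i|)%:E * \int[lam d]_x h (affine_rV a b x))%E.
Proof.
elim: d a b h => [|d IH] a b h a0 mh h0.
  rewrite !integral_rV0//; last by apply: measurableT_comp => //; exact: measurable_affine_rV.
  by rewrite big_ord0 mul1e; congr h; apply/rowP => -[].
have mha : measurable_fun setT (h \o affine_rV a b).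
  by apply: measurableT_comp => //; exact: measurable_affine_rV.
have mhc : measurable_fun setT (h \o @cons_rV R d).
  by apply: measurableT_comp => //; exact: measurable_cons_rV.
have mhac : measurable_fun setT (h \o affine_rV a b \o @cons_rV R d).
  by apply: measurableT_comp => //; exact: measurable_cons_rV.
rewrite ge0_integral_cons_rV// (@ge0_integral_cons_rV _ (h \o affine_rV a b))//=.
rewrite (@ge0_integral_affine _ _ (a ord0) (b ord0) (a0 ord0)); last 2 first.
  exact: (@measurable_fun_fubini_tonelli_F _ _ _ _ _ (lam d) _ mhc (fun=> h0 _)).
  by move=> x; apply: integral_ge0 => y _; exact: h0.
rewrite big_ord_recl EFinM -muleA; congr *%E.
rewrite -ge0_integralZl//; last 3 first.
- exact: (@measurable_fun_fubini_tonelli_F _ _ _ _ _ (lam d) _ mhac (fun=> h0 _)).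
- by move=> x _; apply: integral_ge0 => y _; exact: h0.
- by rewrite lee_fin prodr_ge0.
apply: eq_integral => x _.
under [in RHS]eq_integral do rewrite affine_cons_rV.
apply: (IH _ _ (fun y => h (cons_rV (_, y)))) => //=.
by apply: (measurableT_comp mhc); exact: measurable_pair1.
Qed.

Lemma ge0_integral_prod_rV d (g : 'I_d -> R -> R) :
  (forall i, measurable_fun setT (g i)) -> (forall i x, 0 <= g i x) ->
  (\int[lam d]_x (\prod_i g i ((x : 'rV_d) 0 i))%:E =
   \prod_i \int[lebesgue_measure]_x (g i x)%:E)%E.
Proof.
have mp n (f : 'I_n -> R -> R) : (forall i, measurable_fun setT (f i)) ->
    measurable_fun setT (fun x : borel_rV R n => (\prod_i f i ((x : 'rV_n) 0 i))%:E).
  move=> mf; apply/measurable_EFinP; apply: measurable_prod => i _.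
  by apply: measurableT_comp => //; exact: measurable_coord.
elim: d g => [|d IH] g mg g0.
  by rewrite integral_rV0 ?big_ord0//; exact: mp.
rewrite ge0_integral_cons_rV//; last 2 first.
- exact: mp.
- by move=> x; rewrite lee_fin prodr_ge0.
rewrite big_ord_recl -IH// -ge0_integralZr//; last 3 first.
- by apply/measurable_EFinP; apply: mg.
- by move=> x _; rewrite lee_fin.
- by apply: integral_ge0 => x _; rewrite lee_fin prodr_ge0.
apply: eq_integral => x _; rewrite -ge0_integralZl//; last 3 first.
- exact: (mp _ (fun i => g (lift ord0 i))).
- by move=> y _; rewrite lee_fin prodr_ge0.
- by rewrite lee_fin.
apply: eq_integral => y _; rewrite -EFinM big_ord_recl !mxE unlift_none/=.
by congr ((_ * _)%:E); apply: eq_bigr => i _; rewrite !mxE liftK.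
Qed.

End lebesgue_rV.

(** * Smooth functions and bumps *)

Section smooth.
Context {R : realType} {d : nat}.
Implicit Types f g : 'rV[R]_d -> R.

Local Notation e_ i := (delta_mx 0 i : 'rV[R]_d).

Lemma Ck0 f : Ck 0 f <-> continuous f.
Proof.
split=> [[_ /(_ [::])]|cf]; first exact.
by split=> // s; rewrite leqn0 size_eq0 => /eqP ->.
Qed.

(** The innermost derivative is the last letter of the word [s]; peeling it off with [rcons] gives a
    form suited to induction on k. *)
Lemma CkS k f : Ck k.+1 f <->
  continuous f /\ forall i, (forall x, derivable f x (e_ i)) /\ Ck k (partial i f).
Proof.
have E s i : iter_partial (rcons s i) f = iter_partial s (partial i f).
  by rewrite /iter_partial foldr_rcons.
split=> [[df cf]|[cf dcf]].
  split=> [|i]; first exact: (cf [::]).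
  split=> [x|]; first exact: (df [::]).
  split=> s sk => [j x|]; rewrite -E; [apply: df|apply: cf];
    by rewrite size_rcons ltnS.
split=> s; case/lastP: s => [|s i] //.
- by move=> _ i x; have [] := dcf i.
- by rewrite size_rcons ltnS E => sk j x; have [_ [+ _]] := dcf i; apply.
- by rewrite size_rcons ltnS E => sk; have [_ [_ +]] := dcf i; apply.
Qed.

Lemma Ck_lower k f : Ck k.+1 f -> Ck k f.
Proof. by move=> [df cf]; split=> s sk; [apply/df/ltnW|apply/cf/ltnW]. Qed.

Definition smooth f := forall k, Ck k f.

Lemma smoothP f : smooth f <->
  continuous f /\ forall i, (forall x, derivable f x (e_ i)) /\ smooth (partial i f).
Proof.
split=> [sf|[cf dsf] [|k]]; last 2 first.
- exact/Ck0.
- by apply/CkS; split=> // i; have [? ?] := dsf i; split.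
split=> [|i]; first exact/Ck0.
split=> [|k]; first by have /CkS[_ /(_ i)[]] := sf 1%N.
by have /CkS[_ /(_ i)[]] := sf k.+1.
Qed.

Lemma smooth_continuous f : smooth f -> continuous f.
Proof. by move=> /smoothP[]. Qed.

Lemma smooth_derivable f i x : smooth f -> derivable f x (e_ i).
Proof. by move=> /smoothP[_ /(_ i)[]]. Qed.

Lemma smooth_partial f i : smooth f -> smooth (partial i f).
Proof. by move=> /smoothP[_ /(_ i)[]]. Qed.

Lemma partial_cst (c : R) i : partial i (cst c : 'rV[R]_d -> R) = cst 0.
Proof. by apply/funext => x; rewrite /partial derive_cst. Qed.

Lemma smooth_cst (c : R) : smooth (cst c : 'rV[R]_d -> R).
Proof.
move=> k; elim: k c => [|k IH] c; first by apply/Ck0 => x; exact: cst_continuous.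
apply/CkS; split=> [x|i]; first exact: cst_continuous.
by rewrite partial_cst; split.
Qed.

Lemma CkD k f g : Ck k f -> Ck k g -> Ck k (f \+ g).
Proof.
elim: k f g => [|k IH] f g.
  by move=> /Ck0 cf /Ck0 cg; apply/Ck0 => x; exact: (continuousD (cf x) (cg x)).
move=> /CkS[cf df] /CkS[cg dg]; apply/CkS; split=> [x|i].
  exact: (continuousD (cf x) (cg x)).
have [dfi cfi] := df i; have [dgi cgi] := dg i.
split=> [x|]; first exact: derivableD.
rewrite (_ : partial i _ = partial i f \+ partial i g); first exact: IH.
by apply/funext => x; rewrite /partial deriveD.
Qed.

Lemma CkM k f g : Ck k f -> Ck k g -> Ck k (f \* g).
Proof.
elim: k f g => [|k IH] f g.
  by move=> /Ck0 cf /Ck0 cg; apply/Ck0 => x; exact: (continuousM (cf x) (cg x)).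
move=> f1 g1; have [f2 g2] := (Ck_lower f1, Ck_lower g1).
move: f1 g1 => /CkS[cf df] /CkS[cg dg]; apply/CkS; split=> [x|i].
  exact: (continuousM (cf x) (cg x)).
have [dfi cfi] := df i; have [dgi cgi] := dg i.
split=> [x|]; first exact: derivableM.
rewrite (_ : partial i _ = (f \* partial i g) \+ (g \* partial i f)).
  by apply: CkD; exact: IH.
by apply/funext => x; rewrite /partial deriveM.
Qed.

Lemma smoothM f g : smooth f -> smooth g -> smooth (f \* g).
Proof. by move=> sf sg k; exact: CkM. Qed.

Lemma smooth_prod (I : Type) (r : seq I) (F : I -> 'rV[R]_d -> R) :
  (forall i, smooth (F i)) -> smooth (fun x => \prod_(i <- r) F i x).
Proof.
move=> sF; elim: r => [|i r IH].
  by under eq_fun do rewrite big_nil; exact: smooth_cst.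
by under eq_fun do rewrite big_cons; exact: smoothM.
Qed.

Lemma continuous_coord_comp (F : R -> R) (i : 'I_d) :
  continuous F -> continuous (fun x : 'rV[R]_d => F (x 0 i)).
Proof.
by move=> cF x; apply: continuous_comp; [exact: coord_continuous|exact: cF].
Qed.

Lemma is_derive_coord_comp (F : R -> R) (F' : R) (i j : 'I_d) (x : 'rV[R]_d) :
  is_derive (x 0 i) 1 F F' ->
  is_derive x (e_ j) (fun y => F (y 0 i)) ((i == j)%:R * F').
Proof.
move=> dF; have [<-{j}|ij] := eqVneq i j; rewrite ?mul1r ?mul0r.
  have E : (fun h : R => h^-1 *: (F ((h *: e_ i + x) 0 i) - F (x 0 i))) =
      (fun h => h^-1 *: (F (h *: 1 + x 0 i) - F (x 0 i))).
    by apply/funext => h; rewrite !mxE !eqxx.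
  case: dF => dF <-; split; first by rewrite /derivable E.
  by rewrite /derive E.
have E : (fun h : R => h^-1 *: (F ((h *: e_ j + x) 0 i) - F (x 0 i))) = cst 0.
  by apply/funext => h; rewrite !mxE (negbTE ij) mulr0 add0r subrr scaler0.
split; first by rewrite /derivable E; exact: is_cvg_cst.
by rewrite /derive E lim_cst.
Qed.

Lemma Ck_cstM k (c : R) f : Ck k f -> Ck k (fun x => c * f x).
Proof. by move=> cf; apply: CkM => //; exact: smooth_cst. Qed.

(** Giving the whole tower of derivatives lets the induction on k run over all n at once. *)
Lemma smooth_coord_comp (F : nat -> R -> R) (i : 'I_d) :
  (forall n (s : R), is_derive s (1 : R) (F n) (F n.+1 s)) ->
  smooth (fun x => F 0%N (x 0 i)).
Proof.
move=> dF; suff H k n : Ck k (fun x : 'rV[R]_d => F n (x 0 i)) by move=> k; exact: H.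
elim: k n => [|k IH] n.
  apply/Ck0/continuous_coord_comp => s.
  by apply/differentiable_continuous/derivable1_diffP; have [] := dF n s.
apply/CkS; split=> [x|j].
  apply: continuous_coord_comp => s.
  by apply/differentiable_continuous/derivable1_diffP; have [] := dF n s.
split=> [x|]; first by have [] := is_derive_coord_comp j (dF n (x 0 i)).
rewrite (_ : partial j _ = fun x => (i == j)%:R * F n.+1 (x 0 i)).
  exact: Ck_cstM.
by apply/funext => x; have [_ <-] := is_derive_coord_comp j (dF n (x 0 i)).
Qed.

End smooth.

(** * Smooth bumps built from exp(-1/s) *)

Section bump.
Context {R : realType}.

(* The derivative of s |-> p(1/s) exp(-1/s) has the same form, with p replaced by
   flat_next p below; hence all these functions are smooth on R. *)
Definition flat (p : {poly R}) (s : R) : R :=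
  if 0 < s then p.[s^-1] * expR (- s^-1) else 0.

(** With u = 1/s one has du/ds = - u^2, so the derivative of p(u) exp(-u) in s is (p(u) - p'(u)) u^2
    exp(-u). *)
Definition flat_next (p : {poly R}) : {poly R} := (p - p^`()) * 'X^2.

Lemma horner_le_pow (p : {poly R}) : exists2 C : R, 0 <= C &
  forall u, 1 <= u -> `|p.[u]| <= C * u ^+ (size p).
Proof.
exists (\sum_(i < size p) `|p`_i|) => [|u u1]; first exact: sumr_ge0.
rewrite horner_coef (le_trans (ler_norm_sum _ _ _))// mulr_suml.
apply: ler_sum => i _; rewrite normrM ler_wpM2l//.
rewrite normrX ger0_norm ?(le_trans ler01)//.
by apply: ler_weXn2l => //; exact: ltnW.
Qed.

(** With n the size of p, exp(u) dominates u^(n+2) / (n+2)!: n of these powers absorb p(u), and the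
    remaining two leave the s^2 that makes the difference quotient at 0 tend to 0. *)
Lemma flat_bound (p : {poly R}) : exists2 C : R, 0 <= C &
  forall s, `|s| <= 1 -> `|flat p s| <= C * s ^+ 2.
Proof.
have [C C0 Cp] := horner_le_pow p.
exists (C * ((size p).+2)`!%:R) => [|s s1]; first by rewrite mulr_ge0.
rewrite /flat; case: ifPn => s0; last by rewrite normr0 mulr_ge0 ?sqr_ge0// mulr_ge0.
have u1 : 1 <= s^-1 by rewrite invf_ge1// (le_trans (ler_norm _)).
have u0 : 0 <= s^-1 by rewrite invr_ge0 ltW.
rewrite normrM (ger0_norm (expR_ge0 _)) expRN ler_pdivrMr ?expR_gt0//.
rewrite (le_trans (Cp _ u1))//.
have := expR_ge1Dxn (size p).+1 u0; set n := size p; set e := expR _ => he.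
have : s^-1 ^+ n.+2 <= n.+2`!%:R * e.
  rewrite mulrC -ler_pdivrMr ?ltr0n ?fact_gt0// (le_trans _ he)// lerDr.
  exact: ler01.
move=> /(ler_wpM2l (sqr_ge0 s)).
have -> : s ^+ 2 * s^-1 ^+ n.+2 = s^-1 ^+ n.
  by rewrite -[n.+2]addn2 exprD mulrCA -exprMn mulfV ?lt0r_neq0// expr1n mulr1.
move=> /(ler_wpM2l C0) /le_trans; apply.
by rewrite le_eqVlt; apply/orP; left; apply/eqP; ring.
Qed.

Lemma is_derive_flat (p : {poly R}) (s : R) :
  is_derive s 1 (flat p) (flat (flat_next p) s).
Proof.
have [s0|s0|->] := ltgtP s 0.
- have -> : flat (flat_next p) s = 0 by rewrite /flat ltNge (ltW s0).
  apply: (@near_eq_is_derive _ _ _ (cst 0)).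
  near=> t; rewrite /flat ltNge ifF//; apply/negbTE; rewrite negbK ltW//.
  by near: t; exact: lt_nbhsl.
- have -> : flat (flat_next p) s = (flat_next p).[s^-1] * expR (- s^-1) by rewrite /flat s0.
  have sV : is_derive s (1 : R) (fun t : R => t^-1) (- s ^- 2).
    have := @is_deriveV R id s 1 1 (lt0r_neq0 s0) (is_derive_id _ _).
    by rewrite scaler1; apply.
  have dp := @is_derive1_comp R (horner p) (fun t => t^-1) s _ _ (is_derive_poly p _) sV.
  have de := @is_derive1_comp R expR (fun t => - t^-1) s _ _ (is_derive_expR _) (is_deriveN sV).
  have := is_deriveM dp de.
  rewrite (_ : _ + _ = (flat_next p).[s^-1] * expR (- s^-1)); last first.
    rewrite /flat_next !hornerE /= /GRing.scale/=; field; exact: lt0r_neq0.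
  apply: near_eq_is_derive; near=> t; rewrite /flat ifT//; near: t; exact: lt_nbhsr.
- have -> : flat (flat_next p) 0 = 0 by rewrite /flat ltxx.
  have [C C0 Cp] := flat_bound p.
  suff H : (fun h : R => h^-1 *: (flat p (h *: 1 + 0) - flat p 0)) @ 0^' --> (0 : R).
    by split; [apply/cvg_ex; exists 0|exact: cvg_lim].
  have c0 : (fun h : R => C * `|h|) @ 0^' --> (0 : R).
    rewrite -[X in _ --> X](mulr0 C); apply: cvgM; first exact: cvg_cst.
    rewrite -[X in _ --> X](@normr0 _ R); apply: cvg_norm.
    by move=> A A0; apply: nbhs_dnbhs; exact: A0.
  apply: (@squeeze_cvgr _ _ _ _ (fun h => - (C * `|h|)) (fun h => C * `|h|)).
  - near=> h; rewrite -ler_norml addr0 [_ *: 1]mulr1 {2}/flat ltxx subr0.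
    rewrite [_ *: _]mulrC normrM normfV ler_pdivrMr ?normr_gt0//; last first.
      by near: h; exact: nbhs_dnbhs_neq.
    rewrite -mulrA -normrM -expr2 (@ger0_norm _ (h ^+ 2)) ?sqr_ge0// Cp//.
    by near: h; exact: dnbhs0_le.
  - by rewrite -[X in _ --> X]oppr0; exact: cvgN.
  - exact: c0.
Unshelve. all: by end_near. Qed.

Definition flat0 (n : nat) : R -> R := flat (iter n flat_next 1).

Lemma is_derive_flat0 (n : nat) (s : R) :
  is_derive s (1 : R) (flat0 n) (flat0 n.+1 s).
Proof. exact: is_derive_flat. Qed.

Lemma flat00E (s : R) : flat0 0%N s = if 0 < s then expR (- s^-1) else 0.
Proof. by rewrite /flat0/= /flat; case: ifP; rewrite ?hornerC ?mul1r. Qed.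

Lemma continuous_flat0 n : continuous (flat0 n).
Proof.
move=> s; apply/differentiable_continuous/derivable1_diffP.
by have [] := is_derive_flat0 n s.
Qed.

Definition bump1 (e s : R) := flat0 0%N (e + s) * flat0 0%N (e - s).

Lemma bump1_ge0 e s : 0 <= bump1 e s.
Proof.
by rewrite /bump1 !flat00E; apply: mulr_ge0; case: ifP => _ //; exact: expR_ge0.
Qed.

Lemma bump1_eq0 e s : e <= `|s| -> bump1 e s = 0.
Proof.
rewrite /bump1 !flat00E ler_normr => /orP[] es.
  by rewrite (_ : 0 < e - s = false) ?mulr0//; apply/negbTE; rewrite -leNgt; lra.
by rewrite (_ : 0 < e + s = false) ?mul0r//; apply/negbTE; rewrite -leNgt; lra.
Qed.

Lemma continuous_bump1 e : continuous (bump1 e).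
Proof.
have c1 : continuous (fun s => e + s).
  by move=> s; apply: cvgD; [exact: cvg_cst|exact: cvg_id].
have c2 : continuous (fun s => e - s).
  by move=> s; apply: cvgB; [exact: cvg_cst|exact: cvg_id].
rewrite (_ : bump1 e = (flat0 0 \o (fun s => e + s)) \* (flat0 0 \o (fun s => e - s)))//.
move=> s.
have h1 := continuous_comp (c1 s) (@continuous_flat0 0%N (e + s)).
have h2 := continuous_comp (c2 s) (@continuous_flat0 0%N (e - s)).
by apply: cvgM; [exact: h1|exact: h2].
Qed.

Lemma smooth_bump1 d (e : R) (i : 'I_d) :
  smooth (fun x : 'rV[R]_d => bump1 e (x 0 i)).
Proof.
have sD : smooth (fun x : 'rV[R]_d => flat0 0 (e + x 0 i)).
  apply: (@smooth_coord_comp _ _ (fun n s => flat0 n (e + s))) => n s.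
  have de : is_derive s (1 : R) (fun s : R => e + s) 1.
    by have := is_deriveD (@is_derive_cst R R R e s 1) (@is_derive_id R R s 1); rewrite add0r.
  have := @is_derive1_comp R (flat0 n) (fun s => e + s) s _ _ (is_derive_flat0 n _) de.
  by rewrite mulr1.
have sB : smooth (fun x : 'rV[R]_d => flat0 0 (e - x 0 i)).
  have := @smooth_coord_comp _ d (fun n s => (-1) ^+ n * flat0 n (e - s)) i.
  under eq_fun do rewrite expr0 mul1r; apply => n s.
  have de : is_derive s (1 : R) (fun s : R => e - s) (-1).
    by have := is_deriveB (@is_derive_cst R R R e s 1) (@is_derive_id R R s 1); rewrite sub0r.
  have := @is_derive1_comp R (flat0 n) (fun s => e - s) s _ _ (is_derive_flat0 n _) de.
  move=> /(@is_deriveZ _ _ _ _ ((-1) ^+ n)); rewrite /GRing.scale/=.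
  by rewrite exprSr -mulrA (mulrC (-1)).
exact: smoothM sD sB.
Qed.

Definition bump d (e : R) (x : 'rV[R]_d) : R := \prod_i bump1 e (x 0 i).

Lemma smooth_bump d e : smooth (@bump d e).
Proof. by apply: smooth_prod => i; exact: smooth_bump1. Qed.

Lemma bump_ge0 d e x : 0 <= @bump d e x.
Proof. by apply: prodr_ge0 => i _; exact: bump1_ge0. Qed.

Lemma bump_eq0 d e (x : 'rV[R]_d) : 0 < e -> e <= `|x| -> bump e x = 0.
Proof.
move=> e0 ex; have x0 : `|x| != 0 by rewrite gt_eqF// (lt_le_trans e0).
have [[i j] xij] := mx_norm_neq0 x0; rewrite -[LHS]/(mx_norm x) /= (ord1 i) in xij.
rewrite /bump (bigD1 j)//= bump1_eq0 ?mul0r//.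
by rewrite -xij.
Qed.

End bump.

(** * Locally finite measures and mollifiers *)

Section rV_norm.
Context {R : realType} {d : nat}.
Implicit Types x y : 'rV[R]_d.

Lemma rV_norm_leP x (M : R) : 0 <= M ->
  (`|x| <= M) <-> (forall i, `|x 0 i| <= M).
Proof.
move=> M0; rewrite -[`|x|]/(mx_norm x) mx_normrE; split=> [/bigmax_leP[_ +] i|xM].
  by move=> /(_ (0, i)); apply.
by apply/bigmax_leP; split=> // -[i j] _ /=; rewrite ord1.
Qed.

Lemma rV_norm_coord x i : `|x 0 i| <= `|x|.
Proof. by have /rV_norm_leP := lexx `|x|; apply. Qed.

Definition cube (M : R) : set 'rV[R]_d := [set x | `|x| <= M].

Lemma closed_cube M : closed (cube M).
Proof.
have := @closed_closed_ball_ R 'rV[R]_d 0 M; rewrite /closed_ball_/cube.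
by under eq_set do rewrite sub0r normrN.
Qed.

Lemma compact_cube M : compact (cube M).
Proof.
apply: bounded_closed_compact; last exact: closed_cube.
exists M; split; first exact: num_real.
by move=> N MN x xM /=; apply: le_trans xM _; exact: ltW.
Qed.

Lemma compact_sub_cube (C : set 'rV[R]_d) : compact C ->
  exists2 M, 1 <= M & C `<=` cube M.
Proof.
move=> /compact_bounded[M [_ CM]]; exists (Num.max M 1 + 1).
  by rewrite (le_trans (_ : 1 <= Num.max M 1)) ?lerDl// le_max lexx orbT.
by move=> x Cx; apply: (CM _ _ x Cx); rewrite ltr_pwDr// le_max lexx.
Qed.

Lemma continuous_borel (f : 'rV[R]_d -> R) : continuous f ->
  measurable_fun [set: borel_rV R d] (f : borel_rV R d -> R).
Proof.
move=> /continuousP cf; apply: (measurability _ (RGenOpens.measurableE R)).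
move=> _ [_ [a [b ->] <-]]; rewrite setTI; apply: open_borel.
by apply: cf; exact: interval_open.
Qed.

Lemma measurable_norm_rV : measurable_fun [set: borel_rV R d] (fun x : borel_rV R d => `|x : 'rV[R]_d|).
Proof. exact: (@continuous_borel _ (@norm_continuous R 'rV[R]_d)). Qed.

Lemma measurable_cube M : measurable (cube M : set (borel_rV R d)).
Proof. by apply: closed_borel; exact: closed_cube. Qed.

End rV_norm.
#[local] Hint Extern 0 (measurable (cube _)) => solve [exact: measurable_cube] : core.

Lemma integral_indic_itvcc {R : realType} (a b : R) :
  (\int[lebesgue_measure]_s (\1_`[a, b] s)%:E = (if a < b then b - a else 0)%:E)%E.
Proof.
rewrite integral_indic//.
rewrite setIT.
by rewrite [LHS]lebesgue_measure_itv/= lte_fin; case: ifP; rewrite -?EFinB.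
Qed.

Section locally_finite.
Context {R : realType} {d : nat}.
Implicit Types (mu : {measure set (borel_rV R d) -> \bar R}) (f : borel_rV R d -> R).

Definition locally_finite mu := forall C : set 'rV[R]_d, compact C -> (mu C < +oo)%E.

Lemma integrable_bounded_support mu f (B M : R) : locally_finite mu ->
  measurable_fun setT f -> (forall x, `|f x| <= B) ->
  (forall x : 'rV_d, M < `|x| -> f x = 0) -> mu.-integrable setT (EFin \o f).
Proof.
move=> muoo mf fB fM.
have E : f = f \_ (cube M).
  apply/funext => x; rewrite patchE; case: ifPn => //.
  by rewrite notin_setE /cube/= => /negP; rewrite -ltNge => /fM.
rewrite E -restrict_EFin; apply: (@integrable_mkcond _ _ _ mu (cube M) (EFin \o f) _).1 => //.
apply: measurable_bounded_integrable => //.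
- by apply: muoo; exact: compact_cube.
- exact: measurable_funS mf.
- exists B; split; first exact: num_real.
  by move=> N BN x _ /=; apply: le_trans (fB x) _; exact: ltW.
Qed.

Lemma lebesgue_rV_locally_finite : locally_finite (@lebesgue_rV R d).
Proof.
move=> C cC; have [M M1 CM] := compact_sub_cube cC.
have M0 : 0 <= M by rewrite (le_trans ler01).
have mC := compact_borel cC.
apply: (@le_lt_trans _ _ (lebesgue_rV d (cube M))); first by apply: le_measure; rewrite ?inE.
have := @integral_indic _ _ _ (@lebesgue_rV R d) setT measurableT _ (measurable_cube M).
rewrite setIT => <-.
under eq_integral => x _.
  (* In the sup norm the indicator of a cube is a product of one-variable indicators. *)
  rewrite (_ : \1_(cube M) x = \prod_i \1_`[-M, M] ((x : 'rV_d) 0 i)); last first.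
    have [xM|/negP xM] := boolP (`|x : 'rV_d| <= M).
      rewrite indicE mem_set// big1// => i _; rewrite indicE mem_set//=.
      by rewrite in_itv/= -ler_norml; move: i; exact/rV_norm_leP.
    rewrite indicE memNset//; apply/esym/eqP.
    have /existsNP[i iM] : ~ forall i, `|(x : 'rV_d) 0 i| <= M by move/rV_norm_leP => /(_ M0).
    by rewrite (bigD1 i)//= indicE memNset ?mul0r//= in_itv/= -ler_norml.
  over.
rewrite (@ge0_integral_prod_rV R d (fun _ => \1_`[-M, M]))//.
rewrite (_ : (\prod_i _)%E = (\prod_(i < d) (if - M < M then M + M else 0))%:E) ?ltry//.
rewrite -prodEFin; apply: eq_bigr => i _.
by rewrite integral_indic_itvcc opprK.
Qed.

End locally_finite.

Section mollifier.
Context {R : realType} {d : nat}.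
Local Notation lam := (@lebesgue_rV R d).

Lemma integral_bump1 (e : R) : 0 < e ->
  (0 < \int[lebesgue_measure]_s (bump1 e s)%:E < +oo)%E.
Proof.
move=> e0.
have mb : measurable_fun setT (bump1 e) by apply: continuous_measurable_fun; exact: continuous_bump1.
have mitv (a b : R) : measurable (`[a, b] : set (measurableTypeR R)) by exact: measurable_itv.
apply/andP; split.
  (* For |s| <= e/2 both e + s and e - s are at least e/2, which bounds each factor of the bump from
     below. *)
  apply: (@lt_le_trans _ _ (\int[lebesgue_measure]_s (expR (- (e / 2)^-1) ^+ 2 * \1_`[- (e / 2), e / 2] s)%:E)%E).
    under eq_integral do rewrite EFinM.
    rewrite ge0_integralZl//; last by apply/measurable_EFinP.
    rewrite integral_indic_itvcc gtrN ?divr_gt0//.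
    by rewrite -EFinM lte_fin mulr_gt0 ?exprn_gt0 ?expR_gt0// opprK addr_gt0 ?divr_gt0.
  apply: ge0_le_integral => //.
  - by apply/measurable_EFinP; apply: measurable_funM.
  - exact/measurable_EFinP.
  move=> s _; rewrite lee_fin indicE; have [|] := boolP (s \in _); last by rewrite mulr0 bump1_ge0.
  rewrite mulr1 inE/= in_itv/= => /andP[s1 s2]; rewrite /bump1 !flat00E !ifT; [|lra|lra].
  by rewrite expr2 ler_pM ?expR_ge0// ler_expR lerN2 lef_pV2 ?posrE; lra.
apply: (@le_lt_trans _ _ (\int[lebesgue_measure]_s (\1_`[- e, e] s)%:E)%E).
  apply: ge0_le_integral => //.
  - by move=> s _; rewrite lee_fin bump1_ge0.
  - exact/measurable_EFinP.
  - by apply/measurable_EFinP.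
  move=> s _; rewrite lee_fin; have [se|es] := ltP `|s| e; last by rewrite bump1_eq0.
  rewrite indicE mem_set/=; last by rewrite in_itv/= -ler_norml ltW.
  have [? ?] : - e < s /\ s < e by move: se; rewrite ltr_norml => /andP.
  rewrite /bump1 !flat00E !ifT; [|lra|lra].
  by rewrite mulr_ile1 ?expR_ge0// -expR0 ler_expR oppr_le0 invr_ge0; lra.
by rewrite integral_indic_itvcc ltry.
Qed.

(** The bump is a product over the coordinates, so its integral is the d-th power of the
    one-variable integral; dividing by it normalises the mass. *)
Lemma mollifier (e : R) : 0 < e -> exists rho : 'rV[R]_d -> R,
  [/\ smooth rho, forall x, 0 <= rho x, forall x, e <= `|x| -> rho x = 0 &
      (\int[lam]_x (rho x)%:E = 1)%E].
Proof.
move=> e0; have := integral_bump1 e0; set I := (\int[_]_s _)%E => /andP[I0 Ioo].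
have If : I = (fine I)%:E by rewrite fineK// ge0_fin_numE// ltW.
have c0 : 0 < fine I by rewrite -lte_fin -If.
exists (fun x => (fine I ^+ d)^-1 * bump e x); split.
- by move=> k; apply: Ck_cstM; exact: smooth_bump.
- by move=> x; rewrite mulr_ge0 ?bump_ge0// invr_ge0 exprn_ge0// ltW.
- by move=> x ex; rewrite bump_eq0 ?mulr0.
under eq_integral do rewrite EFinM.
have mb : measurable_fun setT (bump1 e) by apply: continuous_measurable_fun; exact: continuous_bump1.
rewrite ge0_integralZl//; last 3 first.
- by apply/measurable_EFinP; apply: continuous_borel; exact/smooth_continuous/smooth_bump.
- by move=> x _; rewrite lee_fin bump_ge0.
- by rewrite lee_fin invr_ge0 exprn_ge0// ltW.
rewrite (@ge0_integral_prod_rV R d (fun _ => bump1 e))//; last by move=> _ x; exact: bump1_ge0.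
rewrite -/I If prodEFin prodr_const card_ord -EFinM mulVf//.
by rewrite expf_eq0 gt_eqF ?andbF.
Qed.

End mollifier.

(** * Convolution *)

Section line.
Context {R : realType} {d : nat}.
Implicit Types (f : 'rV[R]_d -> R) (x y v : 'rV[R]_d).
Local Notation e_ i := (delta_mx 0 i : 'rV[R]_d).

Lemma is_derive_line f v x (t : R) : derivable f (t *: v + x) v ->
  is_derive t (1 : R) (fun s : R => f (s *: v + x)) ('D_v f (t *: v + x)).
Proof.
have E : (fun h : R => h^-1 *: (f ((h *: 1 + t) *: v + x) - f (t *: v + x))) =
    (fun h : R => h^-1 *: (f (h *: v + (t *: v + x)) - f (t *: v + x))).
  by apply/funext => h; rewrite [h *: 1]mulr1 scalerDl addrA.
by move=> df; split; rewrite /derivable /derive E.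
Qed.

Lemma line_lipschitz f v (B : R) : (forall x, derivable f x v) ->
  (forall x, `|'D_v f x| <= B) -> forall x t, `|f (t *: v + x) - f x| <= B * `|t|.
Proof.
move=> df fB.
have H x t : 0 <= t -> `|f (t *: v + x) - f x| <= B * `|t|.
  move=> t0; have dl (s : R) := is_derive_line (df (s *: v + x)).
  have cl : {within `[0, t], continuous (fun s => f (s *: v + x))}.
    apply: continuous_subspaceT => s.
    by apply/differentiable_continuous/derivable1_diffP; have [] := dl s.
  have [c _] := @MVT_segment R _ _ 0 t t0 (fun s _ => dl s) cl.
  rewrite scale0r add0r subr0 => ->.
  by rewrite normrM ler_wpM2r.
move=> x t; have [/H//|t0] := leP 0 t.
have := H (t *: v + x) (- t); rewrite oppr_ge0 => /(_ (ltW t0)).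
by rewrite addrA -scalerDl addNr scale0r add0r normrN distrC.
Qed.

Lemma rV_lipschitz f (B : R) : 0 <= B ->
  (forall i x t, `|f (t *: e_ i + x) - f x| <= B * `|t|) ->
  forall x y, `|f x - f y| <= B * d%:R * `|x - y|.
Proof.
move=> B0 fB x y.
(* A path from x to y along the axes: [z n] has exchanged the first n coordinates. *)
pose z n : 'rV[R]_d := \row_j (if (j < n)%N then y 0 j else x 0 j).
have z0 : z 0%N = x by apply/rowP => j; rewrite !mxE.
have zd : z d = y by apply/rowP => j; rewrite !mxE ltn_ord.
suff H n : (n <= d)%N -> `|f x - f (z n)| <= B * n%:R * `|x - y|.
  by have := H d (leqnn d); rewrite zd.
elim: n => [_|n IH nd]; first by rewrite z0 subrr normr0 mulr0 mul0r.
have zS : z n.+1 = (y 0 (Ordinal nd) - x 0 (Ordinal nd)) *: e_ (Ordinal nd) + z n.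
  apply/rowP => j; rewrite !mxE eqxx/= ltnS leq_eqVlt -(inj_eq val_inj)/=.
  case: ltngtP => [jn|jn|jn]/=; rewrite ?mulr0 ?add0r//.
  by rewrite mulr1 (_ : Ordinal nd = j) ?subrK//; exact: val_inj.
rewrite (le_trans (ler_distD (f (z n)) _ _))// -natr1 mulrDr mulr1 mulrDl lerD ?IH 1?ltnW//.
rewrite distrC zS (le_trans (fB _ _ _))// ler_wpM2l//.
by rewrite distrC; have := rV_norm_coord (x - y) (Ordinal nd); rewrite !mxE.
Qed.

Lemma near_dist_lt x (r : R) : 0 < r -> \forall y \near x, `|x - y| < r.
Proof.
move=> r0; apply/nbhs_ballP; exists r => // y.
by rewrite -ball_normE.
Qed.

Definition ccsmooth f := smooth f /\ exists M, forall x, M < `|x| -> f x = 0.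

Lemma bounded_ccontinuous f (M : R) : continuous f ->
  (forall x, M < `|x| -> f x = 0) -> exists2 B, 0 <= B & forall x, `|f x| <= B.
Proof.
move=> cf fM.
have := compact_bounded (continuous_compact (continuous_subspaceT cf) (@compact_cube _ _ M)).
move=> [B [_ fB]]; exists (`|B| + 1) => [|x]; first by rewrite addr_ge0.
have [xM|/fM ->] := leP `|x| M; last by rewrite normr0 addr_ge0.
by apply: (fB _ _ (f x)); [rewrite ltr_pwDr// ler_norm|exists x].
Qed.

Lemma partial_eq0 f i (M : R) : (forall x, M < `|x| -> f x = 0) ->
  forall x, M < `|x| -> partial i f x = 0.
Proof.
move=> fM x Mx; rewrite [RHS](_ : 0 = partial i (cst (0 : R)) x); last by rewrite partial_cst.
rewrite /partial.
apply: near_eq_derive; near=> y; apply: fM.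
near: y; exact: (cvgr_gt _ (@norm_continuous R 'rV[R]_d x) _ Mx).
Unshelve. all: by end_near. Qed.

Lemma ccsmooth_partial f i : ccsmooth f -> ccsmooth (partial i f).
Proof.
by move=> [sf [M fM]]; split; [exact: smooth_partial|exists M; exact: partial_eq0].
Qed.

Lemma ccsmooth_bounded f : ccsmooth f -> exists2 B, 0 <= B & forall x, `|f x| <= B.
Proof. by move=> [/smooth_continuous cf [M fM]]; exact: bounded_ccontinuous fM. Qed.

Lemma ccsmooth_partial_bounded f : ccsmooth f ->
  exists2 B, 0 <= B & forall i x, `|partial i f x| <= B.
Proof.
move=> sf; have /choice[B HB] i : exists B, 0 <= B /\ forall x, `|partial i f x| <= B.
  by have [B B0 fB] := ccsmooth_bounded (ccsmooth_partial i sf); exists B.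
exists (\sum_i B i) => [|i x]; first by apply: sumr_ge0 => i _; have [] := HB i.
rewrite (le_trans ((HB i).2 x))// (bigD1 i)//= lerDl.
by apply: sumr_ge0 => j _; have [] := HB j.
Qed.

End line.

Section convolution.
Context {R : realType} {d : nat}.
Local Notation lam := (@lebesgue_rV R d).
Local Notation e_ i := (delta_mx 0 i : 'rV[R]_d).
Implicit Types (k : 'rV[R]_d -> R) (g : borel_rV R d -> R) (x y : 'rV[R]_d).

Definition conv k g x : R := \int[lam]_y (k (x - y) * g y).

Lemma continuous_shift k x : continuous k -> continuous (fun y : 'rV[R]_d => k (x - y)).
Proof.
move=> ck y; apply: (@continuous_comp _ _ _ (fun y : 'rV[R]_d => x - y : 'rV[R]_d) k); last exact: ck.
exact: (@continuousB R 'rV[R]_d 'rV[R]_d (cst x) id y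
  (@cst_continuous 'rV[R]_d 'rV[R]_d x y) (@cvg_id _ (nbhs y))).
Qed.

Lemma measurable_kernel k x : continuous k ->
  measurable_fun setT (fun y : borel_rV R d => k (x - y)).
Proof. by move=> ck; apply: continuous_borel; exact: continuous_shift. Qed.

Lemma integrable_conv k g x (B : R) : continuous k -> (forall z, `|k z| <= B) ->
  lam.-integrable setT (EFin \o g) ->
  lam.-integrable setT (EFin \o (fun y => k (x - y) * g y)).
Proof.
move=> ck kB ig.
apply: (@integrableMr _ _ _ lam _ measurableT (fun y => k (x - y)) (EFin \o g)) => //.
  exact: measurable_kernel.
by exists B; split; [exact: num_real|move=> N BN y _ /=; apply: le_trans (kB _) _; exact: ltW].
Qed.

(** All derivatives fall on the kernel. Its partials are bounded, so a multiple of |g| dominates the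
    differentiated integrand and g need only be integrable. *)
Lemma conv_derive k g i x : ccsmooth k -> lam.-integrable setT (EFin \o g) ->
  is_derive x (e_ i) (conv k g) (conv (partial i k) g x).
Proof.
move=> sk ig; have [sk1 _] := sk; have ck := smooth_continuous sk1.
have [B B0 kB] := ccsmooth_bounded sk.
have [B' B'0 kB'] := ccsmooth_partial_bounded sk.
pose f (t : R) y := k (t *: e_ i + (x - y)) * g y.
have dk (t : R) y := is_derive_line (@smooth_derivable _ _ k i (t *: e_ i + (x - y)) sk1).
have df (t : R) y : is_derive t (1 : R) (f ^~ y) (partial i k (t *: e_ i + (x - y)) * g y).
  have := is_deriveM (dk t y) (@is_derive_cst R R R (g y) t 1).
  by rewrite scaler0 add0r [_ *: _]mulrC.
have fE t : f t = (fun y => k ((t *: e_ i + x) - y) * g y).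
  by apply/funext => y; rewrite /f addrA.
have int_f (t : R) : lam.-integrable setT (EFin \o f t).
  by rewrite fE; exact: integrable_conv kB ig.
have dfE t y : partial1of2 f t y = partial i k (t *: e_ i + (x - y)) * g y.
  by rewrite partial1of2E; have [_ ->] := df t y.
have intG : lam.-integrable setT (EFin \o (fun y => B' * `|g y|)).
  have := integrableZl measurableT B' (integrable_norm ig).
  by under eq_fun do rewrite /= -EFinM.
have I0 : [set` `]-1, 1[] (0 : R) by rewrite /= in_itv/=; lra.
have H := @cvg_differentiation_under_integral R _ _ lam f setT measurableT 0 (-1) 1 I0
  (fun t _ => int_f t) (fun t y _ _ => @ex_derive _ _ _ _ _ _ _ (df t y)) _
  (fun y => mulr_ge0 B'0 (normr_ge0 (g y))) intG.
have {}H : h^-1 *: (conv k g (h *: e_ i + x) - conv k g x) @[h --> 0^'] --> conv (partial i k) g x.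
  rewrite (_ : conv (partial i k) g x = \int[lam]_y partial1of2 f 0 y); last first.
    by apply: eq_Rintegral => y _; rewrite dfE scale0r add0r.
  under eq_fun => h.
    rewrite (_ : conv k g (h *: e_ i + x) = \int[lam]_y f (h + 0) y); last first.
      by rewrite addr0 fE.
    rewrite (_ : conv k g x = \int[lam]_y f 0 y); last by rewrite fE scale0r add0r.
    over.
  apply: H => t y _ _; rewrite dfE normrM ler_wpM2r//.
by split; [apply/cvg_ex; eexists; exact: H|exact: cvg_lim].
Qed.

(** The kernel is Lipschitz, and the convolution inherits this with its constant multiplied by the
    L^1 norm of g. *)
Lemma conv_continuous k g : ccsmooth k -> lam.-integrable setT (EFin \o g) ->
  continuous (conv k g).
Proof.
move=> sk ig; have [sk1 _] := sk; have ck := smooth_continuous sk1.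
have [B B0 kB] := ccsmooth_bounded sk.
have [B' B'0 kB'] := ccsmooth_partial_bounded sk.
have kL := rV_lipschitz B'0
  (fun i => line_lipschitz (fun x => @smooth_derivable _ _ k i x sk1) (kB' i)).
pose L := B' * d%:R * \int[lam]_y `|g y|.
have L0 : 0 <= L by rewrite !mulr_ge0// Rintegral_ge0.
have cL x y : `|conv k g x - conv k g y| <= L * `|x - y|.
  have ix := integrable_conv x ck kB ig; have iy := integrable_conv y ck kB ig.
  rewrite /conv -RintegralB//; apply: (le_trans (le_normr_Rintegral _ _)) => //.
    by have := integrableB measurableT ix iy.
  have : lam.-integrable setT (EFin \o (fun z => B' * d%:R * `|x - y| * `|g z|)).
    have := integrableZl measurableT (B' * d%:R * `|x - y|) (integrable_norm ig).
    by under eq_fun do rewrite /= -EFinM.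
  move=> iL; rewrite /L -mulrA [X in _ * X]mulrC mulrA.
  rewrite -(RintegralZl (B' * d%:R * `|x - y|) measurableT (integrable_norm ig)).
  apply: le_Rintegral => //.
    by apply: integrable_norm; have := integrableB measurableT ix iy.
  move=> z _; rewrite -mulrBl normrM ler_wpM2r// (le_trans (kL _ _))//.
  by rewrite opprB addrA subrK.
move=> x; apply/(@cvgrPdist_lt _ _ _ (nbhs x) (nbhs_filter x)) => e e0.
have r0 : 0 < e / (L + 1) by rewrite divr_gt0// ltr_pwDr.
apply: (@filterS 'rV[R]_d (nbhs x) (nbhs_filter x) _ _ _ (near_dist_lt x r0)) => y.
rewrite ltr_pdivlMr ?ltr_pwDr// => xy; rewrite (le_lt_trans (cL _ _))//.
by rewrite (le_lt_trans _ xy)// mulrC ler_wpM2l// lerDl.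
Qed.

Lemma conv_smooth k g : ccsmooth k -> lam.-integrable setT (EFin \o g) ->
  smooth (conv k g).
Proof.
move=> sk ig n; elim: n k sk => [|n IH] k sk; first exact/Ck0/conv_continuous.
apply/CkS; split=> [|i]; first exact: conv_continuous.
split=> [x|]; first by have [] := conv_derive i x sk ig.
rewrite (_ : partial i _ = conv (partial i k) g); first exact/IH/ccsmooth_partial.
by apply/funext => x; have [_ E] := conv_derive i x sk ig; exact: E.
Qed.

Lemma conv_eq0 k g (e M : R) x : (forall z, e < `|z| -> k z = 0) ->
  (forall z : 'rV_d, M < `|z| -> g z = 0) -> e + M < `|x| -> conv k g x = 0.
Proof.
move=> ke gM xeM; rewrite /conv.
suff -> : (fun y => k (x - y) * g y) = (fun=> 0) by rewrite Rintegral_cst// mul0r.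
apply/funext => y; have [yM|yM] := ltP M `|y : 'rV_d|; first by rewrite gM ?mulr0.
rewrite ke ?mul0r//; rewrite ltNge; apply/negP => xy; move: xeM; rewrite ltNge => /negP; apply.
by rewrite -(subrK y x) (le_trans (ler_normD _ _))// lerD.
Qed.

End convolution.

(** * Mollification as averaging: approximation and contraction in L^2 *)

Section mollification.
Context {R : realType} {d : nat}.
Local Notation lam := (@lebesgue_rV R d).
Implicit Types (rho : 'rV[R]_d -> R) (g : borel_rV R d -> R) (x y : 'rV[R]_d).

Definition is_mollifier (e : R) rho :=
  [/\ smooth rho, forall x, 0 <= rho x, forall x, e <= `|x| -> rho x = 0 &
      (\int[lam]_x (rho x)%:E = 1)%E].

Variables (e : R) (rho : 'rV[R]_d -> R).
Hypothesis mrho : is_mollifier e rho.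

Lemma mollifier_ccsmooth : ccsmooth rho.
Proof. by have [s _ re _] := mrho; split=> //; exists e => x /ltW; exact: re. Qed.

Let crho : continuous rho.
Proof. by have [/smooth_continuous] := mrho. Qed.

Lemma integral_mollifierB x : (\int[lam]_y (rho (x - y))%:E = 1)%E.
Proof.
have [_ rho0 _ <-] := mrho.
rewrite (@ge0_integral_affine_rV R d (fun=> -1) (x 0) (EFin \o rho))//.
- rewrite big1 ?mul1e; last by move=> i _; rewrite normrN1.
  apply: eq_integral => y _ /=; congr (rho _)%:E.
  by apply/rowP => i; rewrite !mxE mulN1r addrC.
- by apply/measurable_EFinP; exact: continuous_borel.
Qed.

Lemma integral_mollifierBr y : (\int[lam]_x (rho (x - y))%:E = 1)%E.
Proof.
have [_ rho0 _ <-] := mrho.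
rewrite (@ge0_integral_affine_rV R d (fun=> 1) (- y 0) (EFin \o rho))//.
- rewrite big1 ?mul1e; last by move=> i _; rewrite normr1.
  apply: eq_integral => x _ /=; congr (rho _)%:E.
  by apply/rowP => i; rewrite !mxE mul1r.
- by apply/measurable_EFinP; exact: continuous_borel.
Qed.

Lemma integrable_mollifierB x : lam.-integrable setT (EFin \o (fun y => rho (x - y))).
Proof.
have [_ rho0 _ _] := mrho.
apply/integrableP; split; first by apply/measurable_EFinP; exact: measurable_kernel.
under eq_integral do rewrite /= ger0_norm//.
by rewrite integral_mollifierB ltry.
Qed.

Lemma Rintegral_mollifierB x : \int[lam]_y rho (x - y) = 1.
Proof. by rewrite /Rintegral integral_mollifierB. Qed.

Lemma integrable_mollify g x : lam.-integrable setT (EFin \o g) ->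
  lam.-integrable setT (EFin \o (fun y => rho (x - y) * g y)).
Proof.
by have [B _ rB] := ccsmooth_bounded mollifier_ccsmooth; exact: integrable_conv.
Qed.

(** A weighted average of values within r of c stays within r of c. The constant c is not tied to
    [g x]: [H1_approx] averages around a x and compares with f at x. *)
Lemma conv_approx g x c (r : R) : lam.-integrable setT (EFin \o g) ->
  (forall y, `|x - y| < e -> `|g y - c| <= r) -> `|conv rho g x - c| <= r.
Proof.
have [_ rho0 rhoe _] := mrho => ig gc.
have ic a : lam.-integrable setT (EFin \o (fun y => rho (x - y) * a)).
  have := integrableZl measurableT a (integrable_mollifierB x).
  by under eq_fun do rewrite /= -EFinM mulrC.
have Ic a : \int[lam]_y (rho (x - y) * a) = a.
  by rewrite RintegralZr// ?Rintegral_mollifierB ?mul1r//; exact: integrable_mollifierB.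
rewrite ler_distl; apply/andP.
split; [rewrite -[leLHS]Ic|rewrite -[leRHS]Ic]; apply: le_Rintegral => //;
  try exact: integrable_mollify.
all: move=> y _; have [/gc|/rhoe ->] := ltP `|x - y| e; rewrite ?mul0r//.
all: by rewrite ler_distl => /andP[? ?]; rewrite ler_wpM2l.
Qed.

(** Jensen's inequality for the probability density rho(x - y): the variance of g around its mean
    [m] is nonnegative. An infinite second moment makes the claim trivial. *)
Lemma sqr_conv_le g x : lam.-integrable setT (EFin \o g) ->
  (((conv rho g x) ^+ 2)%:E <= \int[lam]_y (rho (x - y) * g y ^+ 2)%:E)%E.
Proof.
move=> ig; have [_ rho0 _ _] := mrho.
have mg2 : measurable_fun setT (fun y : borel_rV R d => rho (x - y) * g y ^+ 2).
  apply: measurable_funM; first exact: measurable_kernel.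
  by apply: measurable_funX; apply/measurable_EFinP; case/integrableP: ig.
have [oo|oo] := ltP (\int[lam]_y (rho (x - y) * g y ^+ 2)%:E)%E +oo%E; last first.
  by rewrite (le_trans _ oo)// leey.
set m := conv rho g x.
have ig2 : lam.-integrable setT (EFin \o (fun y => rho (x - y) * g y ^+ 2)).
  apply/integrableP; split; first exact/measurable_EFinP.
  rewrite (eq_integral (fun y : borel_rV R d => (rho (x - y) * g y ^+ 2)%:E))// => y _.
  by rewrite /= ger0_norm// mulr_ge0// sqr_ge0.
have i1 := integrable_mollify x ig; have i0 := integrable_mollifierB x.
have i2 : lam.-integrable setT (EFin \o (fun y => 2 * m * (rho (x - y) * g y))).
  have := integrableZl measurableT (2 * m) i1.
  by under eq_fun do rewrite /= -EFinM.
have i3 : lam.-integrable setT (EFin \o (fun y => m ^+ 2 * rho (x - y))).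
  have := integrableZl measurableT (m ^+ 2) i0.
  by under eq_fun do rewrite /= -EFinM.
rewrite -[leRHS]fineK; last by rewrite ge0_fin_numE// integral_ge0// => y _; rewrite lee_fin mulr_ge0 ?sqr_ge0.
rewrite lee_fin -/(Rintegral _ _ _).
have -> : m ^+ 2 = \int[lam]_y (2 * m * (rho (x - y) * g y) - m ^+ 2 * rho (x - y)).
  rewrite RintegralB// !RintegralZl// Rintegral_mollifierB -/(conv rho g x) -/m; ring.
apply: le_Rintegral => //; first by have := integrableB measurableT i2 i3.
move=> y _; rewrite -subr_ge0 (_ : _ - _ = rho (x - y) * (g y - m) ^+ 2); last by ring.
by rewrite mulr_ge0 ?sqr_ge0.
Qed.

(** Young's inequality for a kernel of mass 1: Jensen pointwise, then Tonelli, since rho(x - y) has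
    mass 1 in x as well as in y. *)
Lemma young_mollifier g : lam.-integrable setT (EFin \o g) ->
  (\int[lam]_x ((conv rho g x) ^+ 2)%:E <= \int[lam]_x (g x ^+ 2)%:E)%E.
Proof.
move=> ig; have [_ rho0 _ _] := mrho.
have mg : measurable_fun setT (fun y : borel_rV R d => g y ^+ 2).
  by apply: measurable_funX; apply/measurable_EFinP; case/integrableP: ig.
pose F (z : borel_rV R d * borel_rV R d) : \bar R :=
  (rho ((z.1 : 'rV_d) - (z.2 : 'rV_d)) * g z.2 ^+ 2)%:E.
have mF : measurable_fun setT F.
  apply/measurable_EFinP; apply: measurable_funM; last first.
    exact: (measurableT_comp mg).
  apply: (@measurableT_comp _ _ _ _ _ _ (rho : borel_rV R d -> R) _
    (fun z : borel_rV R d * borel_rV R d => (z.1 : 'rV_d) - (z.2 : 'rV_d) : borel_rV R d)).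
    exact: continuous_borel.
  apply: measurable_fun_rV => i; under eq_fun do rewrite !mxE.
  apply: measurable_funB.
    exact: (measurableT_comp (measurable_coord i) measurable_fst).
  exact: (measurableT_comp (measurable_coord i) measurable_snd).
have F0 z : (0 <= F z)%E by rewrite lee_fin mulr_ge0 ?sqr_ge0.
apply: (@le_trans _ _ (\int[lam]_x \int[lam]_y F (x, y))%E).
  apply: ge0_le_integral => //.
  - by move=> x _; rewrite lee_fin sqr_ge0.
  - apply/measurable_EFinP; apply: measurable_funX; apply: continuous_borel.
    by apply: conv_continuous => //; exact: mollifier_ccsmooth.
  - exact: (@measurable_fun_fubini_tonelli_F _ _ _ _ _ lam F mF F0).
  - by move=> x _; exact: sqr_conv_le.
rewrite (fubini_tonelli F mF F0).
under eq_integral => y _.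
  rewrite /F/=; under eq_integral do rewrite mulrC EFinM.
  rewrite ge0_integralZl ?lee_fin ?sqr_ge0//; last 2 first.
  - apply/measurable_EFinP; apply: continuous_borel => x.
    apply: (@continuous_comp _ _ _ (fun x : 'rV[R]_d => x - y : 'rV[R]_d) rho); last exact: crho.
    exact: (@continuousB R 'rV[R]_d 'rV[R]_d id (cst y) x
      (@cvg_id _ (nbhs x)) (@cst_continuous 'rV[R]_d 'rV[R]_d y x)).
  - by move=> x _; rewrite lee_fin.
  rewrite integral_mollifierBr mule1.
  over.
by [].
Qed.

End mollification.

(** * Testing against smooth functions *)

Section testing.
Context {R : realType} {d : nat}.
Local Notation lam := (@lebesgue_rV R d).
Local Notation e_ i := (delta_mx 0 i : 'rV[R]_d).
Implicit Types (f : 'rV[R]_d -> R) (nu : smeasure R d).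

Lemma ccsmooth_test_fun f : ccsmooth f -> test_fun setT f.
Proof.
move=> [sf [M fM]]; split => //.
apply: (@subclosed_compact _ _ (cube M)); [exact: closed_closure|exact: compact_cube|].
have /closure_id -> := @closed_cube R d M.
by apply: closure_subset => x /= /eqP fx; rewrite /cube/= leNgt; apply/negP => /fM.
Qed.

Lemma ccsmooth_integrable (mu : {measure set (borel_rV R d) -> \bar R}) f :
  locally_finite mu -> ccsmooth f -> mu.-integrable setT (EFin \o (f : borel_rV R d -> R)).
Proof.
move=> muoo sf; have [B _ fB] := ccsmooth_bounded sf; have [/smooth_continuous cf [M fM]] := sf.
by apply: (@integrable_bounded_support R d mu f B M) => //; exact: continuous_borel.
Qed.

Lemma ccsmoothM f g : ccsmooth f -> smooth g -> ccsmooth (f \* g).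
Proof.
move=> [sf [M fM]] sg; split; first exact: smoothM.
by exists M => x /fM; rewrite /= => ->; rewrite mul0r.
Qed.

(** The average rho * f at x lies between 0 and a multiple of the integral of f, hence is 0, while
    continuity keeps it within r of [f x]. *)
Lemma integral_eq0_continuous f : ccsmooth f -> (forall x, 0 <= f x) ->
  \int[lam]_x f x = 0 -> forall x, f x = 0.
Proof.
move=> sf f0 If x; apply/eqP; rewrite eq_le f0 andbT.
apply/ler_addgt0Pr => r r0; rewrite add0r.
have cf : continuous f by have [/smooth_continuous] := sf.
have := @cvgrPdist_le _ _ _ (nbhs x) (nbhs_filter x) f (f x).
move=> [/(_ (cf x)) /(_ _ r0) /nbhs_ballP[e /= e0 fe] _].
have [rho mrho] := @mollifier R d e e0.
have ig := ccsmooth_integrable lebesgue_rV_locally_finite sf.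
have := @conv_approx R d e rho mrho f x (f x) r ig.
have [B B0 rB] := ccsmooth_bounded (mollifier_ccsmooth mrho).
have -> : conv rho f x = 0.
  apply/eqP; rewrite eq_le; have [_ rho0 _ _] := mrho; apply/andP; split; last first.
    by apply: Rintegral_ge0 => y _; rewrite mulr_ge0.
  rewrite -(mulr0 B) -If -RintegralZl//; apply: le_Rintegral => //.
  - exact: (integrable_mollify mrho x ig).
  - have := integrableZl measurableT B ig; by under eq_fun do rewrite /= -EFinM.
  - by move=> y _; rewrite ler_wpM2r// (le_trans (ler_norm _)).
rewrite sub0r normrN => H; apply: (le_trans (ler_norm _)); apply: H => y xy.
rewrite distrC; apply: fe; by rewrite -ball_normE.
Qed.

Lemma L2norm_grad_ge0 f : 0 <= L2norm_grad f.
Proof. exact: sqrtr_ge0. Qed.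

(** One vanishing partial derivative is enough: f is then constant on lines parallel to an axis, and
    these leave the support. This excludes a zero denominator, where the quotient in [normHm1] would
    take the default value 0. *)
Lemma L2norm_grad_eq0 f : (0 < d)%N -> ccsmooth f -> L2norm_grad f = 0 -> f = cst 0.
Proof.
move=> d0 sf /eqP; rewrite sqrtr_eq0 => If.
pose i : 'I_d := Ordinal d0.
have spp j : ccsmooth (fun x => partial j f x ^+ 2).
  by apply: ccsmoothM; [exact: ccsmooth_partial|exact: (ccsmooth_partial _ sf).1].
have ii j := ccsmooth_integrable lebesgue_rV_locally_finite (spp j).
have iS : lam.-integrable setT (EFin \o (fun x => \sum_j partial j f x ^+ 2)).
  rewrite (_ : _ \o _ = (fun x => \sum_(j < d) (partial j f x ^+ 2)%:E)%E).
    by apply: integrable_sum => // j _; exact: ii.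
  by apply/funext => x; rewrite /= sumEFin.
have p0 : forall x, partial i f x ^+ 2 = 0.
  apply: (integral_eq0_continuous (spp i)) => [x|]; first exact: sqr_ge0.
  apply/eqP; rewrite eq_le Rintegral_ge0 ?andbT => [|x _]; last exact: sqr_ge0.
  apply: le_trans If; apply: le_Rintegral => // x _.
  by rewrite (bigD1 i)//= lerDl sumr_ge0// => j _; exact: sqr_ge0.
have [sf1 [M fM]] := sf.
apply/funext => x; have df y := @smooth_derivable R d f i y sf1.
have D0 y : `|'D_(e_ i) f y| <= 0.
  by have /eqP := p0 y; rewrite expf_eq0 /= => /eqP; rewrite /partial => ->; rewrite normr0.
(* A shift by this length carries the i-th coordinate of x beyond M. *)
have := line_lipschitz df D0 x (`|M| + `|x| + 1).
rewrite mul0r normr_le0 subr_eq0 => /eqP <-; apply: fM.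
apply: (lt_le_trans _ (rV_norm_coord _ i)); rewrite !mxE !eqxx mulr1.
have := rV_norm_coord x i; rewrite ler_norml => /andP[x1 _].
have M1 := ler_norm M; rewrite ltr_normr; apply/orP; left; lra.
Qed.

Lemma sintegralN nu (f : 'rV[R]_d -> R) :
  (spos nu).-integrable setT (EFin \o (f : borel_rV R d -> R)) ->
  (sneg nu).-integrable setT (EFin \o (f : borel_rV R d -> R)) ->
  sintegral nu setT (fun x => - f x) = - sintegral nu setT f.
Proof.
move=> ip im; rewrite /sintegral.
have E (mu : {measure set (borel_rV R d) -> \bar R}) :
    mu.-integrable setT (EFin \o (f : borel_rV R d -> R)) ->
    \int[mu]_x (- f x) = - \int[mu]_x f x.
  by move=> i; rewrite -mulN1r -RintegralZl//; apply: eq_Rintegral => x _; rewrite mulN1r.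
by rewrite !E// opprK opprB addrC.
Qed.

Lemma ccsmoothN f : ccsmooth f -> ccsmooth (fun x => - f x).
Proof.
move=> sf; have := ccsmoothM sf (@smooth_cst R d (-1)).
by rewrite (_ : _ \* _ = (fun x => - f x))//; apply/funext => x /=; rewrite mulrN1.
Qed.

Lemma L2norm_gradN f : ccsmooth f -> L2norm_grad (fun x => - f x) = L2norm_grad f.
Proof.
move=> [sf _].
have E x : \sum_i partial i (fun x => - f x) x ^+ 2 = \sum_i partial i f x ^+ 2.
  apply: eq_bigr => i _; rewrite -[in RHS]sqrrN; congr (_ ^+ 2).
  rewrite /partial -[RHS]deriveN//; exact: smooth_derivable.
by rewrite /L2norm_grad; under eq_Rintegral do rewrite E.
Qed.

(** The supremum restated without division and with an absolute value, which is obtained by testing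
    with both f and - f. *)
Lemma normHm1_dual nu : (0 < d)%N -> (normHm1 nu < +oo)%E ->
  exists N, [/\ 0 <= N, normHm1 nu = N%:E &
    forall f, ccsmooth f -> `|sintegral nu setT f| <= N * L2norm_grad f].
Proof.
move=> d0 nuoo.
have intf (f : 'rV[R]_d -> R) (sf : ccsmooth f) : (spos nu).-integrable setT (EFin \o (f : borel_rV R d -> R)) /\
    (sneg nu).-integrable setT (EFin \o (f : borel_rV R d -> R)).
  by split; apply: ccsmooth_integrable => //; [exact: spos_lty|exact: sneg_lty].
have ub f : ccsmooth f -> f <> cst 0 ->
    (`|sintegral nu setT f / L2norm_grad f|%:E <= normHm1 nu)%E.
  move=> sf fn0; have [? ?] := intf f sf.
  have [_|_] := ger0P (sintegral nu setT f / L2norm_grad f).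
    by apply: ereal_sup_ubound; exists f => //; split=> //; exact: ccsmooth_test_fun.
  apply: ereal_sup_ubound; exists (fun x => - f x) => /=.
    split; first by apply: ccsmooth_test_fun; exact: ccsmoothN.
    move=> E; apply: fn0; apply/funext => x; apply/eqP; rewrite -oppr_eq0.
    by have := congr1 (fun g => g x) E => /= ->.
  by rewrite sintegralN// L2norm_gradN// mulNr.
(* Some nonzero test function must exist, so that the supremum is not taken over the empty set and
   is nonnegative. *)
have [rho mrho] := @mollifier R d 1 ltr01.
have rho_n0 : rho <> cst 0.
  move=> E; have [_ _ _] := mrho; rewrite E integral0 => /eqP.
  by rewrite eqe eq_sym oner_eq0.
have N0 : (0 <= normHm1 nu)%E.
  by apply: le_trans (ub _ (mollifier_ccsmooth mrho) rho_n0); rewrite lee_fin.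
have NE : normHm1 nu = (fine (normHm1 nu))%:E by rewrite fineK// ge0_fin_numE.
exists (fine (normHm1 nu)); split => //; first exact: fine_ge0.
move=> f sf; have [->|fn0] := pselect (f = cst 0).
  rewrite /sintegral !Rintegral_cst// !mul0r subrr normr0 mulr_ge0 ?fine_ge0//.
  exact: L2norm_grad_ge0.
have n0 : 0 < L2norm_grad f.
  rewrite lt_neqAle L2norm_grad_ge0 andbT eq_sym; apply/eqP => /(L2norm_grad_eq0 d0 sf).
  exact: fn0.
have := ub f sf fn0; rewrite NE lee_fin normrM normfV (ger0_norm (ltW n0)).
by rewrite ler_pdivrMr.
Qed.

End testing.

(** * Testing against Lipschitz functions *)

Section difference_quotients.
Context {R : realType} {d : nat}.
Local Notation lam := (@lebesgue_rV R d).
Local Notation e_ i := (delta_mx 0 i : 'rV[R]_d).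

Lemma Rintegral_translate (h : borel_rV R d -> R) (a : 'rV[R]_d) : measurable_fun setT h ->
  \int[lam]_y h ((y : 'rV_d) + a) = \int[lam]_y h y.
Proof.
move=> mh; rewrite /Rintegral; congr fine.
have E (g : borel_rV R d -> \bar R) : measurable_fun setT g -> (forall x, 0 <= g x)%E ->
    (\int[lam]_y g ((y : 'rV_d) + a)%R = \int[lam]_y g y)%E.
  move=> mg g0; rewrite [RHS](@ge0_integral_affine_rV R d (fun=> 1) (a 0))//.
  rewrite big1 ?mul1e; last by move=> i _; rewrite normr1.
  apply: eq_integral => y _; congr g.
  by apply/rowP => i; rewrite !mxE mul1r.
have mEh : measurable_fun setT (EFin \o h) by exact/measurable_EFinP.
rewrite integralE [RHS]integralE; congr (_ - _)%E.
  rewrite -(E ((EFin \o h)^\+)%E).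
  - by apply: eq_integral => y _; rewrite !funeposE.
  - exact: measurable_funepos.
  - by move=> x; exact: funepos_ge0.
rewrite -(E ((EFin \o h)^\-)%E).
- by apply: eq_integral => y _; rewrite !funenegE.
- exact: measurable_funeneg.
- by move=> x; exact: funeneg_ge0.
Qed.

Lemma Rintegral_le_bound (mu : {measure set (borel_rV R d) -> \bar R}) (h : borel_rV R d -> R) (r M : R) :
  locally_finite mu -> measurable_fun setT h -> (forall x, `|h x| <= r) ->
  (forall x : 'rV_d, M < `|x| -> h x = 0) ->
  `|\int[mu]_x h x| <= r * fine (mu (cube M)).
Proof.
move=> muoo mh hr hM.
have ih := integrable_bounded_support muoo mh hr hM.
apply: (le_trans (le_normr_Rintegral measurableT ih)).
rewrite -Rintegral_cst// [leRHS]Rintegral_mkcond.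
have r0 : 0 <= r by apply: le_trans (hr 0).
apply: le_Rintegral => //; first exact: integrable_norm.
  apply: (@integrable_bounded_support R d mu _ r M) => //.
  - by apply/(measurable_restrictT _ _).1 => //; exact: measurable_cst.
  - by move=> x; rewrite patchE; case: ifP; rewrite ?normr0 ?ger0_norm.
  - by move=> x Mx; rewrite patchE memNset//= /cube/= leNgt Mx.
move=> x _; rewrite patchE; case: ifPn => //.
by rewrite notin_setE/= /cube/= => /negP; rewrite -ltNge => /hM ->; rewrite normr0.
Qed.

Lemma Rintegral_sum (mu : {measure set (borel_rV R d) -> \bar R}) (I : finType)
    (f : I -> borel_rV R d -> R) : (forall i, mu.-integrable setT (EFin \o f i)) ->
  \int[mu]_x (\sum_i f i x) = \sum_i \int[mu]_x f i x.
Proof.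
move=> fi; rewrite /Rintegral.
under eq_integral do rewrite -sumEFin.
rewrite integral_sum// -sum_fine// => i _.
exact: integrable_fin_num (fi i).
Qed.

Variables (v : 'rV[R]_d -> R) (J : 'I_d -> borel_rV R d -> R) (L B M : R).
Hypotheses (L0 : 0 <= L) (vM : forall x, M < `|x| -> v x = 0)
  (vL : forall i x t, `|v (t *: e_ i + x) - v x| <= L * `|t|).
Hypotheses (mJ : forall i, measurable_fun setT (J i)) (J0 : forall i x, 0 <= J i x)
  (JB : forall i x, J i x <= B) (JM : forall i (x : 'rV_d), M < `|x| -> J i x = 0).
(* J i bounds the upper right derivative of v along the i-th axis: v itself, such as
   the modulus of a folded function, need not be differentiable. *)
Hypothesis vJ : forall i x r, 0 < r ->
  \forall t \near 0^'+, `|v (t *: e_ i + x) - v x| <= (J i x + r) * t.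

Let vlip := rV_lipschitz L0 vL.

Lemma lip_continuous : continuous v.
Proof.
have K0 : 0 <= L * d%:R by rewrite mulr_ge0.
move=> x; apply/(@cvgrPdist_lt _ _ _ (nbhs x) (nbhs_filter x)) => e e0.
have r0 : 0 < e / (L * d%:R + 1) by rewrite divr_gt0// ltr_pwDr.
apply: (@filterS 'rV[R]_d (nbhs x) (nbhs_filter x) _ _ _ (near_dist_lt x r0)) => y.
rewrite ltr_pdivlMr ?ltr_pwDr// => xy; rewrite (le_lt_trans (vlip _ _))//.
by rewrite (le_lt_trans _ xy)// mulrC ler_wpM2l// lerDl.
Qed.

Let mv : measurable_fun setT (v : borel_rV R d -> R).
Proof. by apply: continuous_borel; exact: lip_continuous. Qed.

Let iv : lam.-integrable setT (EFin \o (v : borel_rV R d -> R)).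
Proof.
have [C _ vC] := bounded_ccontinuous lip_continuous vM.
exact: (integrable_bounded_support lebesgue_rV_locally_finite mv vC vM).
Qed.

Let iJ i : lam.-integrable setT (EFin \o J i).
Proof.
apply: (integrable_bounded_support lebesgue_rV_locally_finite (mJ i) _ (JM i)).
by move=> x; rewrite ger0_norm; [exact: JB|exact: J0].
Qed.

Section mollified_gradient.
Variables (e : R) (rho : 'rV[R]_d -> R).
Hypothesis mrho : is_mollifier e rho.

(** By translation invariance a difference quotient of rho * v is the average of the same quotient
    of v. The limit is taken along t = 1/(n+1), from the right only, as this is all that [vJ]
    controls. *)
Lemma partial_conv_le i x : `|partial i (conv rho v) x| <= conv rho (J i) x.
Proof.
have [_ rho0 _ _] := mrho; have srho := mollifier_ccsmooth mrho.
have [B' B'0 rB] := ccsmooth_bounded srho.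
have crho : continuous rho by have [/smooth_continuous] := srho.
pose t (n : nat) : R := n.+1%:R^-1.
have t0 n : 0 < t n by rewrite invr_gt0.
have tcvg : t @ \oo --> (0 : R) by exact: cvg_harmonic.
pose D n (y : borel_rV R d) := (t n)^-1 * (v (t n *: e_ i + y) - v y).
have DL n y : `|D n y| <= L.
  by rewrite normrM normfV (gtr0_norm (t0 n)) mulrC ler_pdivrMr// (le_trans (vL _ _ _))// (gtr0_norm (t0 n)).
have mvt n : measurable_fun setT (fun y : borel_rV R d => v (t n *: e_ i + y)).
  apply: continuous_borel => y.
  apply: (@continuous_comp _ _ _ (fun y : 'rV[R]_d => t n *: e_ i + y : 'rV[R]_d) v); last exact: lip_continuous.
  exact: (@continuousD R 'rV[R]_d 'rV[R]_d (cst (t n *: e_ i)) id y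
    (@cst_continuous 'rV[R]_d 'rV[R]_d (t n *: e_ i) y) (@cvg_id _ (nbhs y))).
have mD n : measurable_fun setT (D n).
  by apply: measurable_funM => //; apply: measurable_funB.
pose q n := (t n)^-1 *: (conv rho v (t n *: e_ i + x) - conv rho v x).
have qcvg : q @ \oo --> partial i (conv rho v) x.
  have [dc _] := conv_derive i x srho iv.
  have {}dc : h^-1 *: (conv rho v (h *: e_ i + x) - conv rho v x) @[h --> 0^'] -->
      partial i (conv rho v) x := dc.
  move/cvgr_dnbhsP : dc; apply; split; last exact: tcvg.
  by move=> n; rewrite gt_eqF.
have ivt n : lam.-integrable setT (EFin \o (fun y : borel_rV R d => v (t n *: e_ i + y))).
  have [C _ vC] := bounded_ccontinuous lip_continuous vM.
  apply: (@integrable_bounded_support R d lam _ C (M + `|t n *: e_ i|)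
    lebesgue_rV_locally_finite (mvt n)) => //.
  move=> y My; apply: vM; rewrite addrC (lt_le_trans _ (lerB_normD _ _))//.
  by rewrite ltrBrDr.
have qE n : q n = \int[lam]_y (rho (x - y) * D n y).
  rewrite /q; have -> : conv rho v (t n *: e_ i + x) = \int[lam]_y (rho (x - y) * v (t n *: e_ i + y)).
    rewrite /conv -(Rintegral_translate (t n *: e_ i)); last first.
      by apply: measurable_funM => //; exact: measurable_kernel.
    apply: eq_Rintegral => y _; rewrite (addrC y); congr (rho _ * _).
    by rewrite opprD addrA; congr (_ - _); rewrite addrC addKr.
  rewrite /conv -RintegralB//; last 2 first.
  - exact: (integrable_mollify mrho x (ivt n)).
  - exact: (integrable_mollify mrho x iv).
  rewrite -[LHS]RintegralZl//; last first.
    by have := integrableB measurableT (integrable_mollify mrho x (ivt n)) (integrable_mollify mrho x iv).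
  by apply: eq_Rintegral => y _; rewrite /D; ring.
(* The quotients [D n] need not converge; only the upper limit of their moduli is at most [J i]. The
   maximum with [J i] does converge, to [J i], and dominated convergence applies to it. *)
pose E n y := rho (x - y) * Num.max `|D n y| (J i y).
have mE n : measurable_fun setT (E n : borel_rV R d -> R).
  apply: measurable_funM; first exact: measurable_kernel.
  by apply: measurable_maxr => //; exact: measurableT_comp.
have mEl : measurable_fun setT (fun y : borel_rV R d => rho (x - y) * J i y).
  by apply: measurable_funM => //; exact: measurable_kernel.
have iLB : lam.-integrable setT (EFin \o (fun y => rho (x - y) * (L + B))).
  have := integrableZr measurableT (L + B) (integrable_mollifierB mrho x).
  by under eq_fun do rewrite /= -EFinM.
have EB n y : (`|(E n y)%:E| <= (rho (x - y) * (L + B))%:E)%E.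
  have B0 : 0 <= B by rewrite (le_trans (J0 i y)).
  rewrite /= lee_fin normrM ger0_norm// ler_wpM2l// ger0_norm ?le_max ?normr_ge0//.
  by rewrite ge_max (le_trans (DL _ _)) ?lerDl//= (le_trans (JB _ _))// lerDr.
have EJ y : (E n y)%:E @[n --> \oo] --> (rho (x - y) * J i y)%:E.
  apply: cvg_EFin; first exact: nearW.
  apply: cvgM; first exact: cvg_cst.
  apply/cvgrPdist_le => r r0.
  have [s /= s0 Hs] := vJ i y r0.
  have /cvgrPdist_lt /(_ _ s0) := tcvg.
  apply: filterS => n tn; have Dn := Hs _ tn (t0 n).
  rewrite distrC ger0_norm ?subr_ge0 ?le_max ?lexx ?orbT//.
  rewrite lerBlDr ge_max addrC lerDl (ltW r0) andbT.
  by rewrite /D normrM normfV (gtr0_norm (t0 n)) mulrC ler_pdivrMr.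
have aEJ : {ae lam, forall y : borel_rV R d, [set: borel_rV R d] y ->
    (fun n => (EFin \o E n) y) @ \oo --> (EFin \o (fun y => rho (x - y) * J i y)) y}.
  by apply: aeW => y _; exact: EJ.
have aEB : {ae lam, forall (y : borel_rV R d) n, [set: borel_rV R d] y ->
    (`|(EFin \o E n) y| <= (EFin \o (fun y => rho (x - y) * (L + B))%R) y)%E}.
  by apply: aeW => y n _; exact: EB.
have [_ _ Ecvg] := @dominated_convergence _ _ _ lam setT measurableT
  (fun n => EFin \o E n) (EFin \o (fun y => rho (x - y) * J i y))
  (EFin \o (fun y => rho (x - y) * (L + B)))
  (fun n => (measurable_EFinP _ _).2 (mE n)) ((measurable_EFinP _ _).2 mEl)
  aEJ iLB aEB.
have qle n : `|q n| <= \int[lam]_y E n y.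
  have iD : lam.-integrable setT (EFin \o (fun y => rho (x - y) * D n y)).
    apply: le_integrable iLB => //.
      by apply/measurable_EFinP; apply: measurable_funM => //; exact: measurable_kernel.
    move=> y _ /=; rewrite lee_fin normrM [leRHS]normrM ler_wpM2l// (le_trans (DL _ _))//.
    rewrite (le_trans _ (ler_norm _))// lerDl.
    by rewrite (le_trans (J0 i y)).
  have iEn : lam.-integrable setT (EFin \o E n).
    apply: le_integrable iLB => //; first exact/measurable_EFinP.
    by move=> y _; rewrite (le_trans (EB n y))//= lee_fin ler_norm.
  rewrite qE (le_trans (le_normr_Rintegral _ _))//.
  apply: le_Rintegral => //; first exact: integrable_norm.
  by move=> y _; rewrite normrM ger0_norm// ler_wpM2l// le_max lexx.
have Rcvg : (fun n => \int[lam]_y E n y) @ \oo --> conv rho (J i) x.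
  apply: fine_cvg; rewrite fineK; first exact: Ecvg.
  exact: integrable_fin_num (integrable_mollify mrho x (iJ i)).
apply: (@ler_cvg_to _ _ _ _ _ _ _ _ (cvg_norm qcvg) Rcvg).
by apply: nearW => n; exact: qle.
Qed.

End mollified_gradient.

Let iJ2 i : lam.-integrable setT (EFin \o (fun x => J i x ^+ 2)).
Proof.
have B0 : 0 <= B by rewrite (le_trans (J0 i 0)).
apply: (@integrable_bounded_support R d lam _ (B ^+ 2) M lebesgue_rV_locally_finite).
- exact: measurable_funX.
- by move=> x; rewrite ger0_norm ?sqr_ge0// ler_sqr ?nnegrE.
- by move=> x /(JM i) ->; rewrite expr0n.
Qed.

Lemma ccsmooth_conv_lip (e : R) rho : is_mollifier e rho -> ccsmooth (conv rho v).
Proof.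
move=> mrho; have srho := mollifier_ccsmooth mrho; split; first exact: conv_smooth.
exists (e + M) => x; apply: conv_eq0 => // z /ltW ez.
by have [_ _ + _] := mrho; apply.
Qed.

Lemma L2norm_grad_conv_le (e : R) rho : is_mollifier e rho ->
  L2norm_grad (conv rho v) <= Num.sqrt (\sum_i \int[lam]_x (J i x ^+ 2)).
Proof.
move=> mrho; have srho := mollifier_ccsmooth mrho.
have sc := ccsmooth_conv_lip mrho.
have sq f : ccsmooth f -> lam.-integrable setT (EFin \o (fun x => f x ^+ 2)).
  move=> sf; apply: (ccsmooth_integrable lebesgue_rV_locally_finite (f := fun x => f x ^+ 2)).
  by apply: ccsmoothM => //; have [] := sf.
apply: ler_wsqrtr.
rewrite Rintegral_sum//; last by move=> i; apply: sq; exact: ccsmooth_partial.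
apply: ler_sum => i _.
have sJ : ccsmooth (conv rho (J i)).
  split; first exact: conv_smooth.
  exists (e + M) => x; apply: conv_eq0 => z; last exact: JM.
  by move=> /ltW; have [_ _ + _] := mrho; apply.
apply: (@le_trans _ _ (\int[lam]_x (conv rho (J i) x ^+ 2))).
  apply: le_Rintegral => //; first by apply: sq; exact: ccsmooth_partial.
    exact: sq.
  move=> x _; rewrite -[leLHS]real_normK ?num_real//.
  have h := partial_conv_le mrho i x.
  by rewrite ler_sqr// nnegrE (le_trans _ h).
apply: fine_le.
- exact: integrable_fin_num (sq _ sJ).
- exact: integrable_fin_num (iJ2 i).
- exact: (young_mollifier mrho (iJ i)).
Qed.

Lemma lipschitz_test nu N : 0 <= N ->
  (forall f, ccsmooth f -> `|sintegral nu setT f| <= N * L2norm_grad f) ->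
  `|sintegral nu setT v| <= N * Num.sqrt (\sum_i \int[lam]_x (J i x ^+ 2)).
Proof.
move=> N0 HN; set S := Num.sqrt _.
(* For e <= 1 both v and rho * v vanish off the cube of radius 1 + M. They differ by at most L d e
   there, so the error is at most L d e C and disappears with e, while the gradient bound does not
   depend on e. *)
pose C := fine (spos nu (cube (1 + M))) + fine (sneg nu (cube (1 + M))).
have C0 : 0 <= C by rewrite addr_ge0// fine_ge0.
have K0 : 0 <= L * d%:R by rewrite mulr_ge0.
suff H (e : R) : 0 < e -> e <= 1 -> `|sintegral nu setT v| <= N * S + L * d%:R * e * C.
  apply/ler_addgt0Pr => r r0.
  pose a := L * d%:R * C + 1; have a0 : 0 < a by rewrite ltr_pwDr// mulr_ge0.
  have r0' : 0 < Num.min 1 (r / a) by rewrite lt_min ltr01 divr_gt0.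
  rewrite (le_trans (H _ r0' _)) ?ge_min ?lexx// lerD2l mulrAC.
  rewrite (@le_trans _ _ (a * (r / a)))//.
    by rewrite ler_pM ?mulr_ge0 ?(ltW r0') ?lerDl ?ge_min ?lexx ?orbT.
  by rewrite mulrC divfK ?gt_eqF.
move=> e0 e1; have [rho mrho] := @mollifier R d e e0.
have sc := ccsmooth_conv_lip mrho.
have cc : continuous (conv rho v) by have [/smooth_continuous] := sc.
have close x : `|v x - conv rho v x| <= L * d%:R * e.
  rewrite distrC; apply: (conv_approx mrho) => // y xy.
  by rewrite (le_trans (vlip _ _))// ler_wpM2l// distrC ltW.
have far (x : 'rV_d) : 1 + M < `|x| -> v x - conv rho v x = 0.
  move=> Mx; rewrite vM ?sub0r; last by move: Mx; lra.
  rewrite (@conv_eq0 R d rho v e M x) ?oppr0//; last by move: Mx; lra.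
  by move=> z /ltW; have [_ _ + _] := mrho; apply.
have mdiff : measurable_fun setT (fun x : borel_rV R d => v x - conv rho v x).
  by apply: measurable_funB; [exact: mv|exact: (continuous_borel cc)].
have bd (mu : {measure set (borel_rV R d) -> \bar R}) : locally_finite mu ->
    `|\int[mu]_x v x - \int[mu]_x conv rho v x| <= L * d%:R * e * fine (mu (cube (1 + M))).
  move=> muoo; rewrite -RintegralB//.
  - exact: Rintegral_le_bound.
  - have [B' _ vB] := bounded_ccontinuous lip_continuous vM.
    exact: (integrable_bounded_support muoo mv vB vM).
  - exact: ccsmooth_integrable.
have bp := bd _ (@spos_lty _ _ nu); have bn := bd _ (@sneg_lty _ _ nu).
have hc : `|sintegral nu setT (conv rho v)| <= N * S.
  by rewrite (le_trans (HN _ sc))// ler_wpM2l//; exact: (L2norm_grad_conv_le mrho).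
rewrite /C mulrDr addrA.
move: hc bp bn; rewrite /sintegral !ler_norml => /andP[? ?] /andP[? ?] /andP[? ?].
by apply/andP; split; lra.
Qed.

End difference_quotients.

(** * Extension by reflection *)

Section fold.
Context {R : realType}.
Variable M : R.
Hypothesis M0 : 0 < M.

(* Even reflection across s = M and s = - M, for |s| <= 3 M. *)
Definition fold1 (s : R) : R := Num.max (Num.min s (2 * M - s)) (- (2 * M) - s).

Lemma fold1_mid s : `|s| <= M -> fold1 s = s.
Proof.
rewrite ler_norml => /andP[s1 s2]; rewrite /fold1 min_l; last lra.
by rewrite max_l//; lra.
Qed.

Lemma fold1_right s : M <= s -> fold1 s = 2 * M - s.
Proof. by move=> Ms; have M0' := M0; rewrite /fold1 min_r; [rewrite max_l//; lra|lra]. Qed.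

Lemma fold1_left s : s <= - M -> fold1 s = - (2 * M) - s.
Proof. by move=> Ms; have M0' := M0; rewrite /fold1 min_l; [rewrite max_r//; lra|lra]. Qed.

Lemma fold1P s : [\/ `|s| <= M /\ fold1 s = s, M <= s /\ fold1 s = 2 * M - s |
  s <= - M /\ fold1 s = - (2 * M) - s].
Proof.
have M0' := M0.
have [h|h] := leP `|s| M; first by apply: Or31; rewrite fold1_mid.
have [sM|sM] := leP M s; first by apply: Or32; rewrite fold1_right.
have ? : s <= - M by move: h; rewrite ltr_normr => /orP[?|?]; lra.
by apply: Or33; rewrite fold1_left.
Qed.

Lemma fold1_le s : `|s| <= 2 * M -> `|fold1 s| <= M.
Proof.
have M0' := M0.
rewrite ler_norml => /andP[s1 s2].
by have [[? ->]|[? ->]|[? ->]] := fold1P s => //; rewrite ler_norml; apply/andP; split; lra.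
Qed.

Lemma fold1_lip s t : `|fold1 s - fold1 t| <= `|s - t|.
Proof.
have M0' := M0.
have [st|st] := ler0P (s - t); have [[/ler_normlP[? ?] ->]|[? ->]|[? ->]] := fold1P s;
  have [[/ler_normlP[? ?] ->]|[? ->]|[? ->]] := fold1P t;
  rewrite ler_norml; apply/andP; split; lra.
Qed.

(** At the kinks s = M and s = - M the left and right slopes differ, but to the right of any point
    [fold1] is affine with slope 1 or -1 for a while. This is why difference quotients are taken on
    one side. *)
Lemma fold1_deriv s : exists2 e, 0 < e & exists2 a : R, `|a| = 1 &
  forall t, 0 < t < e -> fold1 (t + s) = a * t + fold1 s.
Proof.
have M0' := M0.
have [sM|sM] := leP M s.
  exists 1 => //; exists (-1); first by rewrite normrN1.
  by move=> t /andP[t0 _]; rewrite !fold1_right; lra.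
have [sNM|sNM] := leP (- M) s.
  exists (M - s); first by rewrite subr_gt0.
  exists 1; first by rewrite normr1.
  move=> t /andP[t0 te]; rewrite !fold1_mid; [lra| |]; rewrite ler_norml; apply/andP; split; lra.
exists (- M - s); first by rewrite subr_gt0.
exists (-1); first by rewrite normrN1.
by move=> t /andP[t0 te]; rewrite !fold1_left; lra.
Qed.

Lemma measurable_fold1 : measurable_fun setT fold1.
Proof.
apply: measurable_maxr; last by apply: measurable_funB.
by apply: measurable_minr => //; apply: measurable_funB.
Qed.

Variable d : nat.
Local Notation lam := (@lebesgue_rV R d).
Local Notation e_ i := (delta_mx 0 i : 'rV[R]_d).

Definition fold (x : 'rV[R]_d) : 'rV[R]_d := \row_i fold1 (x 0 i).

Lemma measurable_fold : measurable_fun setT (fold : borel_rV R d -> borel_rV R d).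
Proof.
apply: measurable_fun_rV => i; under eq_fun do rewrite mxE.
exact: (measurableT_comp measurable_fold1 (measurable_coord i)).
Qed.

Lemma fold_id x : `|x| <= M -> fold x = x.
Proof.
move=> /(rV_norm_leP _ (ltW M0)) xM; apply/rowP => i.
by rewrite mxE fold1_mid.
Qed.

Lemma fold_cube x : `|x| <= 2 * M -> `|fold x| <= M.
Proof.
have M20 : 0 <= 2 * M by rewrite mulr_ge0// ltW.
move=> /(rV_norm_leP _ M20) xM; apply/(rV_norm_leP _ (ltW M0)) => i.
by rewrite mxE fold1_le.
Qed.

(** Folding treats the coordinates separately, so a displacement along an axis is folded into one
    along the same axis and partial derivatives do not mix. *)
Lemma fold_line i x t :
  fold (t *: e_ i + x) = (fold1 (t + x 0 i) - fold1 (x 0 i)) *: e_ i + fold x.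
Proof.
apply/rowP => j; rewrite !mxE eqxx/=.
by have [->|ij] := eqVneq j i; rewrite ?mulr1 ?subrK// ?mulr0 !add0r.
Qed.

(** On each coordinate [fold] is the identity or one of two reflections, which makes 3^d
    measure-preserving affine maps, indexed by [s]. The sum of h 1_Q over all of them contains the
    term for the actual fold, and the other terms are nonnegative. *)
Lemma ge0_integral_fold (h : borel_rV R d -> \bar R) : measurable_fun setT h ->
  (forall x, 0 <= h x)%E ->
  (\int[lam]_(x in cube (2 * M)) h (fold x) <= (3 ^ d)%:R%:E * \int[lam]_(x in cube M) h x)%E.
Proof.
move=> mh h0.
pose a (s : {ffun 'I_d -> 'I_3}) i : R := if s i == 0 then 1 else -1.
pose b (s : {ffun 'I_d -> 'I_3}) i : R :=
  if s i == 0 then 0 else if s i == 1 then 2 * M else - (2 * M).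
pose g : borel_rV R d -> \bar R := h \_ (cube M).
have mg : measurable_fun setT g.
  by apply/(measurable_restrictT _ _).1 => //; exact: measurable_funS mh.
have g0 x : (0 <= g x)%E by rewrite /g patchE; case: ifP.
have mga s : measurable_fun setT (g \o affine_rV (a s) (b s)).
  by apply: measurableT_comp => //; exact: measurable_affine_rV.
have Ig s : (\int[lam]_x g (affine_rV (a s) (b s) x) = \int[lam]_x g x)%E.
  rewrite [RHS](@ge0_integral_affine_rV R d (a s) (b s))//; last first.
    by move=> i; rewrite /a; case: ifP; rewrite ?oppr_eq0 oner_eq0.
  rewrite big1 ?mul1e// => i _; rewrite /a; case: ifP; by rewrite ?normrN normr1.
rewrite [in leLHS]integral_mkcond [in leRHS]integral_mkcond -/g.
apply: (@le_trans _ _ (\int[lam]_x \sum_(s : {ffun 'I_d -> 'I_3}) g (affine_rV (a s) (b s) x))%E).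
  apply: ge0_le_integral => //.
  - by move=> x _; rewrite patchE; case: ifP.
  - apply/(measurable_restrictT _ _).1 => //; apply: measurable_funTS.
    exact: (measurableT_comp mh measurable_fold).
  - by apply: emeasurable_sum => s _; exact: mga.
  move=> x _; rewrite patchE; case: ifPn => [|_]; last by apply: sume_ge0.
  rewrite inE/= /cube/= => xM.
  have /choice[s Hs] i : exists k : 'I_3, fold1 ((x : 'rV_d) 0 i) =
      (if k == 0 then 1 else -1) * (x : 'rV_d) 0 i +
      (if k == 0 then 0 else if k == 1 then 2 * M else - (2 * M)).
    have [[_ ->]|[_ ->]|[_ ->]] := fold1P ((x : 'rV_d) 0 i).
    - by exists 0; rewrite eqxx mul1r addr0.
    - by exists 1 => /=; rewrite mulN1r addrC.
    - by exists 2%:R => /=; rewrite mulN1r addrC.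
  rewrite (bigD1 (finfun s))//= (_ : affine_rV _ _ x = fold x); last first.
    by apply/rowP => i; rewrite !mxE Hs /a /b !ffunE.
  rewrite /g patchE mem_set//=; last exact: fold_cube.
  by rewrite leeDl// sume_ge0.
rewrite ge0_integral_sum//.
under eq_bigr do rewrite Ig.
by rewrite sumr_const mule_natl cardT -cardE card_ffun !card_ord.
Qed.

End fold.

(** * Testing against a folded function times a cutoff *)

Section fold_test.
Context {R : realType} {d : nat}.
Local Notation lam := (@lebesgue_rV R d).
Local Notation e_ i := (delta_mx 0 i : 'rV[R]_d).
Variables (M M' T B0 B1 : R) (theta p v : 'rV[R]_d -> R).
Hypotheses (M0 : 0 < M) (M'M : M' <= 2 * M) (T0 : 0 <= T) (B00 : 0 <= B0) (B10 : 0 <= B1).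
Hypotheses (theta1 : forall x, `|theta x| <= 1)
  (thetaL : forall x y, `|theta x - theta y| <= T * `|x - y|).
Hypotheses (dp : forall i (x : 'rV[R]_d), derivable p x (e_ i)) (pB : forall x, `|p x| <= B0)
  (dpB : forall i x, `|partial i p x| <= B1) (cdp : forall i, continuous (partial i p)).
Local Notation F := (@fold R M d).
(** A condition on increments covers both theta p(F) and its modulus. *)
Hypotheses (vw : forall x y, `|v x - v y| <= `|theta x * p (F x) - theta y * p (F y)|)
  (vM' : forall x, M' < `|x| -> v x = 0).

Let norm_delta (t : R) i : `|t *: e_ i| <= `|t|.
Proof. by apply/(rV_norm_leP _ (normr_ge0 t)) => j; rewrite !mxE eqxx/=; case: eqP => _; rewrite ?mulr1// mulr0 normr0. Qed.

Let plip i (x : 'rV[R]_d) (t : R) : `|p (t *: e_ i + x) - p x| <= B1 * `|t|.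
Proof. exact: (line_lipschitz (@dp i) (dpB i)). Qed.

Let pFlip i (x : 'rV[R]_d) (t : R) : `|p (F (t *: e_ i + x)) - p (F x)| <= B1 * `|t|.
Proof.
rewrite fold_line (le_trans (plip _ _ _))// ler_wpM2l// (le_trans (fold1_lip _ _ _))//.
by rewrite addrK.
Qed.

Let vdiff i (x : 'rV[R]_d) (t : R) : `|v (t *: e_ i + x) - v x| <=
  T * `|t| * `|p (F (t *: e_ i + x))| + `|p (F (t *: e_ i + x)) - p (F x)|.
Proof.
rewrite (le_trans (vw _ _))//.
set a := theta _; set b := p _; set a' := theta x; set b' := p _.
rewrite (_ : _ - _ = (a - a') * b + a' * (b - b')); last by ring.
apply: (le_trans (ler_normD _ _)); apply: lerD; rewrite normrM.
  by rewrite ler_wpM2r// (le_trans (thetaL _ _))// ler_wpM2l// addrK.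
exact: ler_piMl (normr_ge0 _) (theta1 _).
Qed.

Definition fold_grad i (x : borel_rV R d) : R :=
  (T * `|p (F x)| + `|partial i p (F x)|) * \1_(cube M') x.

Let mp : measurable_fun setT (p : borel_rV R d -> R).
Proof. by apply: continuous_borel; exact: (lip_continuous B10 plip). Qed.

Let mdp i : measurable_fun setT (partial i p : borel_rV R d -> R).
Proof. exact: (continuous_borel (@cdp i)). Qed.

Let mF : measurable_fun setT (F : borel_rV R d -> borel_rV R d).
Proof. exact: measurable_fold. Qed.

Let mgrad i : measurable_fun setT (fold_grad i).
Proof.
apply: measurable_funM; last exact: measurable_indic.
apply: measurable_funD.
  apply: measurable_funM => //; apply: measurableT_comp => //; exact: (measurableT_comp mp mF).
apply: measurableT_comp => //; exact: (measurableT_comp (mdp i) mF).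
Qed.

Let grad0 i x : 0 <= fold_grad i x.
Proof. by rewrite mulr_ge0// addr_ge0// mulr_ge0. Qed.

Let gradB i x : fold_grad i x <= T * B0 + B1.
Proof.
rewrite /fold_grad indicE; case: (_ \in _); rewrite ?mulr1 ?mulr0.
  by rewrite lerD// ler_wpM2l.
by rewrite addr_ge0// mulr_ge0.
Qed.

Let grad_out i (x : 'rV_d) : M' < `|x| -> fold_grad i x = 0.
Proof. by move=> xM; rewrite /fold_grad indicE memNset ?mulr0//= /cube/= leNgt xM. Qed.

Let v_grad i (x : 'rV[R]_d) (r : R) : 0 < r ->
  \forall t \near 0^'+, `|v (t *: e_ i + x) - v x| <= (fold_grad i x + r) * t.
Proof.
move=> r0; have [xM|xM] := ltP M' `|x|.
  exists (`|x| - M'); rewrite /= ?subr_gt0// => t /=; rewrite sub0r normrN => tx t0.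
  rewrite !vM' ?subrr ?normr0 ?mulr_ge0 ?addr_ge0 ?(ltW r0) ?(ltW t0)//.
  rewrite addrC (lt_le_trans _ (lerB_normD _ _))// ltrBrDl -ltrBrDr (le_lt_trans (norm_delta _ _))//.
have [e e0 [a a1 He]] := fold1_deriv M0 (x 0 i).
have := @dp i (F x) => /derivableP[]; rewrite /derivable => cq Dq.
have {}cq : h^-1 *: (p (h *: e_ i + F x) - p (F x)) @[h --> 0^'] --> partial i p (F x) := cq.
move/cvgrPdist_le : cq => /(_ _ (divr_gt0 r0 (ltr0Sn _ 1)))[s /= s0 Hs].
(* For t < b the product T B1 t^2 of the increments of theta and of p(F) is at most (r/2) t; the
   other r/2 pays for the difference quotient of p. *)
pose b := r / (2 * (T * B1) + 1).
have b0 : 0 < b by rewrite divr_gt0// ltr_pwDr// !mulr_ge0.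
exists (Num.min e (Num.min s b)); first by rewrite /= !lt_min e0 s0.
move=> t /=; rewrite sub0r normrN !lt_min => /and3P[te ts tb] t0.
rewrite (gtr0_norm t0) in te ts tb.
have -> : fold_grad i x = T * `|p (F x)| + `|partial i p (F x)|.
  by rewrite /fold_grad indicE mem_set ?mulr1.
apply: (le_trans (vdiff _ _ _)); rewrite (gtr0_norm t0).
have h1 : `|p (F (t *: e_ i + x))| <= `|p (F x)| + B1 * t.
  have := pFlip i x t; rewrite (gtr0_norm t0) => h.
  by rewrite -[X in `|X|](subrK (p (F x))) (le_trans (ler_normD _ _))// addrC lerD2l.
(* The folded increment is a t with a = 1 or -1, so the two-sided derivative of p at [F x] is
   used. *)
have h2 : `|p (F (t *: e_ i + x)) - p (F x)| <= (`|partial i p (F x)| + r / 2) * t.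
  rewrite fold_line He ?t0// addrK.
  have at0 : a * t != 0 by rewrite mulf_neq0 ?(gt_eqF t0)// -normr_eq0 a1 oner_eq0.
  have nat : `|a * t| = t by rewrite normrM a1 mul1r gtr0_norm.
  have := Hs (a * t); rewrite /= sub0r normrN nat => /(_ ts at0) h.
  rewrite -ler_pdivrMr//.
  have -> (y : R) : `|y| / t = `|(a * t)^-1 * y| by rewrite normrM normfV nat mulrC.
  rewrite -[X in `|X|](subrK (partial i p (F x))) (le_trans (ler_normD _ _))// addrC lerD2l.
  by rewrite distrC.
have h3 : T * (B1 * t) <= r / 2.
  move: tb; rewrite /b ltr_pdivlMr; last by rewrite ltr_pwDr// !mulr_ge0.
  move=> tb; nra.
have : T * t * `|p (F (t *: e_ i + x))| <= T * t * (`|p (F x)| + B1 * t).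
  by rewrite ler_wpM2l// mulr_ge0// ltW.
nra.
Qed.

Local Notation D := (cube M).

Let intQ (f : borel_rV R d -> R) b : measurable_fun setT f -> (forall x, `|f x| <= b) ->
  lam.-integrable D (EFin \o f).
Proof.
move=> mf fb; apply: measurable_bounded_integrable => //.
- exact: (lebesgue_rV_locally_finite (@compact_cube R d M)).
- exact: measurable_funS mf.
- exists b; split; [exact: num_real|move=> N bN x _ /=].
  by apply: le_trans (fb x) _; exact: ltW.
Qed.

Let sqB (f : borel_rV R d -> R) b : 0 <= b -> (forall x, `|f x| <= b) ->
  forall x, `|f x ^+ 2| <= b ^+ 2.
Proof. by move=> b0 fb x; rewrite normrX ler_sqr ?nnegrE. Qed.

Let ip2 : lam.-integrable D (EFin \o (fun x => p x ^+ 2)).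
Proof. by apply: (intQ (measurable_funX 2 mp)); exact: (sqB B00 pB). Qed.

Let idp2 i : lam.-integrable D (EFin \o (fun x => partial i p x ^+ 2)).
Proof. by apply: (intQ (measurable_funX 2 (mdp i))); exact: (sqB B10 (dpB i)). Qed.

(** From (T a + b)^2 <= (T^2 + 1) (a^2 + b^2), with a factor 2 to spare. *)
Let c := 2 * (T ^+ 2 + 1).
Let c0 : 0 <= c. Proof. by rewrite mulr_ge0// addr_ge0// sqr_ge0. Qed.

Let fold_grad_int i : \int[lam]_x (fold_grad i x ^+ 2) <=
  (3 ^ d)%:R * c * (\int[lam]_(x in D) (p x ^+ 2) + \int[lam]_(x in D) (partial i p x ^+ 2)).
Proof.
pose h (x : borel_rV R d) : R := c * (p x ^+ 2 + partial i p x ^+ 2).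
have h0 x : 0 <= h x by rewrite mulr_ge0// addr_ge0 ?sqr_ge0.
have mh : measurable_fun setT h.
  apply: measurable_funM => //; apply: measurable_funD; apply: measurable_funX; [exact: mp|exact: mdp].
have ih : lam.-integrable D (EFin \o h).
  have := integrableZl (measurable_cube M) c (integrableD (measurable_cube M) ip2 (idp2 i)).
  by under eq_fun do rewrite /= -EFinD -EFinM.
have -> : (3 ^ d)%:R * c * (\int[lam]_(x in D) (p x ^+ 2) + \int[lam]_(x in D) (partial i p x ^+ 2)) =
    fine ((3 ^ d)%:R%:E * \int[lam]_(x in D) (h x)%:E)%E.
  rewrite fineM//; last exact: integrable_fin_num ih.
  rewrite -mulrA; congr *%R; rewrite -RintegralD// -RintegralZl//.
  by have := integrableD (measurable_cube M) ip2 (idp2 i).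
apply: fine_le.
- apply: integrable_fin_num => //.
  apply: (@integrable_bounded_support R d lam _ ((T * B0 + B1) ^+ 2) M' lebesgue_rV_locally_finite).
  + exact: measurable_funX.
  + apply: sqB => [|x]; first by rewrite addr_ge0// mulr_ge0.
    by rewrite ger0_norm.
  + by move=> x /(grad_out i) ->; rewrite expr0n.
- by rewrite fin_numM//; exact: integrable_fin_num ih.
apply: le_trans (@ge0_integral_fold R M M0 d (EFin \o h) _ _); last 2 first.
- exact/measurable_EFinP.
- by move=> x; rewrite lee_fin.
rewrite [leRHS]integral_mkcond; apply: ge0_le_integral => //.
- by move=> x _; rewrite lee_fin sqr_ge0.
- by apply/measurable_EFinP; exact: measurable_funX.
- apply/(measurable_restrictT _ _).1 => //; apply: measurable_funTS.
  by apply/measurable_EFinP; exact: (measurableT_comp mh mF).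
move=> x _; rewrite patchE /fold_grad indicE.
have [xM|xM] := boolP (x \in cube M'); last first.
  by rewrite mulr0 expr0n; case: ifP; rewrite lee_fin.
rewrite mulr1 ifT; last by move: xM; rewrite !inE /cube/= => /le_trans; apply.
rewrite lee_fin /h /c.
have := sqr_ge0 (T * `|partial i p (F x)| - `|p (F x)|).
rewrite -[p (F x) ^+ 2]real_normK ?num_real// -[partial i p (F x) ^+ 2]real_normK ?num_real//.
have := sqr_ge0 (T * `|p (F x)| - `|partial i p (F x)|).
set a := `|p _|; set b := `|partial _ _ _|; have := sqr_ge0 a; have := sqr_ge0 (T * b); have := sqr_ge0 b.
have := sqr_ge0 (T * a); nra.
Qed.

Lemma fold_test nu N : (0 < d)%N -> 0 <= N ->
  (forall f, ccsmooth f -> `|sintegral nu setT f| <= N * L2norm_grad f) ->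
  `|sintegral nu setT v| <= N * Num.sqrt ((3 ^ d * d)%:R * (2 * (T ^+ 2 + 1))) *
    Num.sqrt (\int[lam]_(x in cube M) (p x ^+ 2) +
              \sum_i \int[lam]_(x in cube M) (partial i p x ^+ 2)).
Proof.
move=> d0 N0 HN.
have L0 : 0 <= T * B0 + B1 by rewrite addr_ge0// mulr_ge0.
have vL i (x : 'rV[R]_d) (t : R) : `|v (t *: e_ i + x) - v x| <= (T * B0 + B1) * `|t|.
  rewrite (le_trans (vdiff _ _ _))// mulrDl lerD//.
  by rewrite mulrAC ler_wpM2r// ler_wpM2l.
apply: (le_trans (lipschitz_test L0 vM' vL mgrad grad0 gradB grad_out v_grad N0 HN)).
rewrite -mulrA ler_wpM2l// -sqrtrM; last by rewrite mulr_ge0.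
apply: ler_wsqrtr.
set P := \int[lam]_(x in _) _; set Q := \sum_i \int[lam]_(x in cube M) (partial i p x ^+ 2).
have P0 : 0 <= P by apply: Rintegral_ge0 => x _; exact: sqr_ge0.
have Q0 : 0 <= Q.
  by apply: sumr_ge0 => i _; apply: Rintegral_ge0 => x _; exact: sqr_ge0.
(* The L^2 part [P] occurs once for each of the d directions, whence the factor d. *)
apply: (@le_trans _ _ (\sum_(i < d) ((3 ^ d)%:R * c * (P + \int[lam]_(x in D) (partial i p x ^+ 2))))).
  by apply: ler_sum => i _; exact: fold_grad_int.
rewrite -mulr_sumr big_split/= sumr_const card_ord -/Q -/c natrM -[P *+ d]mulr_natl.
have k0 : 0 <= (3 ^ d)%:R * c by rewrite mulr_ge0// c0.
have d1 : 1 <= d%:R :> R by rewrite ler1n.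
rewrite [leRHS](_ : _ = (3 ^ d)%:R * c * (d%:R * P + d%:R * Q)); last first.
  by rewrite (mulrAC (3 ^ d)%:R) -[LHS]mulrA mulrDr.
by rewrite ler_wpM2l// lerD2l ler_peMl.
Qed.

End fold_test.

(** * Measures with a sign outside a compact set *)

Section cutoff.
Context {R : realType}.

Definition clamp (s : R) : R := Num.max 0 (Num.min s 1).

Lemma clampP s : [\/ s <= 0 /\ clamp s = 0, (0 <= s <= 1) /\ clamp s = s | 1 <= s /\ clamp s = 1].
Proof.
rewrite /clamp; have [s0|s0] := lerP s 0.
  by apply: Or31; rewrite min_l ?max_l// (le_trans s0).
have [s1|s1] := lerP s 1; first by apply: Or32; rewrite max_r ?(ltW s0).
by apply: Or33; rewrite max_r ?ler01 ?(ltW s1).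
Qed.

Lemma clamp_lip s t : `|clamp s - clamp t| <= `|s - t|.
Proof.
have [st|st] := ler0P (s - t);
  have [[? ->]|[/andP[? ?] ->]|[? ->]] := clampP s;
  have [[? ->]|[/andP[? ?] ->]|[? ->]] := clampP t;
  rewrite ler_norml; apply/andP; split; lra.
Qed.

Lemma clamp_le s t : s <= t -> clamp s <= clamp t.
Proof.
move=> st; have [[? ->]|[/andP[? ?] ->]|[? ->]] := clampP s;
  have [[? ->]|[/andP[? ?] ->]|[? ->]] := clampP t; lra.
Qed.

Variables (d : nat) (r : R).
Hypothesis r1 : 1 <= r.
Implicit Types x y : 'rV[R]_d.

Definition cutoff (k : R) x : R := clamp (k - `|x| / r).

Let r0 : 0 < r. Proof. by rewrite (lt_le_trans ltr01). Qed.

Lemma cutoff_lip k x y : `|cutoff k x - cutoff k y| <= `|x - y|.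
Proof.
rewrite (le_trans (clamp_lip _ _))// opprB addrC addrA subrK -mulrBl normrM.
rewrite (@le_trans _ _ (`|x - y| * 1))//; last by rewrite mulr1.
rewrite ler_pM// ?normfV ?(gtr0_norm r0) ?invf_le1//.
by rewrite distrC; exact: ler_dist_dist.
Qed.

Lemma cutoff_1 k x : `|x| <= (k - 1) * r -> cutoff k x = 1.
Proof.
move=> xk; have h : `|x| / r <= k - 1 by rewrite ler_pdivrMr.
by rewrite /cutoff; have [[? ->]|[/andP[? ?] ->]|[? ->]] := clampP (k - `|x| / r) => //; lra.
Qed.

Lemma cutoff_0 k x : k * r <= `|x| -> cutoff k x = 0.
Proof.
move=> xk; have h : k <= `|x| / r by rewrite ler_pdivlMr.
by rewrite /cutoff; have [[? ->]|[/andP[? ?] ->]|[? ->]] := clampP (k - `|x| / r) => //; lra.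
Qed.

Lemma cutoff_ge0 k x : 0 <= cutoff k x.
Proof. by rewrite /cutoff /clamp le_max lexx. Qed.

Lemma cutoff_le1 k x : cutoff k x <= 1.
Proof. by rewrite /cutoff /clamp ge_max ler01 ge_min lexx orbT. Qed.

Lemma cutoff_le k k' x : k <= k' -> cutoff k x <= cutoff k' x.
Proof. by move=> kk; apply: clamp_le; rewrite lerD2r. Qed.

End cutoff.

Section one_signed.
Context {R : realType} {d : nat}.
Implicit Types mu : {measure set (borel_rV R d) -> \bar R}.

(** Since h vanishes on K, both measures may be restricted to the complement of K, and the
    restrictions are ordered on every Borel set. *)
Lemma le_Rintegral_measure mu1 mu2 (K : set 'rV[R]_d) (h : borel_rV R d -> R) (b M : R) :
  locally_finite mu1 -> locally_finite mu2 -> closed K ->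
  (forall B : set (borel_rV R d), measurable B -> B `<=` ~` K -> (mu2 B <= mu1 B)%E) ->
  measurable_fun setT h -> (forall x, 0 <= h x <= b) ->
  (forall x : 'rV_d, M < `|x| -> h x = 0) -> (forall x, K x -> h x = 0) ->
  \int[mu2]_x h x <= \int[mu1]_x h x.
Proof.
move=> mu1oo mu2oo cK mu12 mh h0b hM hK.
have hb x : `|h x| <= b by have /andP[? ?] := h0b x; rewrite ger0_norm.
have h0 x : 0 <= h x by have /andP[] := h0b x.
have mKC : measurable (~` K : set (borel_rV R d)).
  by apply: measurableC; exact: (@closed_borel R d).
have i1 := integrable_bounded_support mu1oo mh hb hM.
have i2 := integrable_bounded_support mu2oo mh hb hM.
apply: fine_le; [exact: integrable_fin_num i2|exact: integrable_fin_num i1|].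
have E mu : (\int[mu]_x (h x)%:E = \int[mrestr mu mKC]_x (h x)%:E)%E.
  have hE (m : {measure set (borel_rV R d) -> \bar R}) :
      (\int[m]_x (h x)%:E = \int[m]_(x in ~` K) (h x)%:E)%E.
    rewrite [RHS]integral_mkcond; apply: eq_integral => x _; rewrite patchE.
    by case: ifPn => //; rewrite notin_setE /setC/= => /contrapT/hK ->.
  rewrite hE [RHS]hE; apply: eq_measure_integral => A mA AK.
  by rewrite /= /mrestr setIidl.
rewrite (E mu1) (E mu2); apply: ge0_le_measure_integral => //.
- by move=> S mS; apply: (mu12 _ (measurableI _ _ mS mKC)) => x [].
- exact/measurable_EFinP.
Qed.

End one_signed.

Section signed_outside.
Context {R : realType} {d : nat}.
Local Notation lam := (@lebesgue_rV R d).
Local Notation e_ i := (delta_mx 0 i : 'rV[R]_d).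
Variables (r B0 B1 : R) (K : set 'rV[R]_d) (p : 'rV[R]_d -> R).
Hypotheses (r1 : 1 <= r) (cK : closed K) (Kr : K `<=` cube r).
Hypotheses (B00 : 0 <= B0) (B10 : 0 <= B1).
Hypotheses (dp : forall i (x : 'rV[R]_d), derivable p x (e_ i)) (pB : forall x, `|p x| <= B0)
  (dpB : forall i x, `|partial i p x| <= B1) (cdp : forall i, continuous (partial i p)).
Variables (nu : smeasure R d) (N : R).
Hypotheses (d0 : (0 < d)%N) (N0 : 0 <= N).
Hypothesis HN : forall f, ccsmooth f -> `|sintegral nu setT f| <= N * L2norm_grad f.
Hypothesis nuK : nonpos_on nu (~` K) \/ nonneg_on nu (~` K).

Local Notation M := (3 * r).
Local Notation F := (@fold R M d).
Local Notation eta := (@cutoff R d r 2).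
(** On Q the first cutoff is 1, so [zeta] is 1 - eta there. It vanishes on K, and also beyond radius
    4r, well inside the cube of radius 2M = 6r on which the fold is controlled. *)
Local Notation zeta := (fun x : 'rV[R]_d => cutoff r 4 x - cutoff r 2 x).

(** The inner 2 is the Lipschitz constant of [zeta], a difference of two 1-Lipschitz cutoffs; it
    serves for [eta] as well. *)
Let C := N * Num.sqrt ((3 ^ d * d)%:R * (2 * (2 ^+ 2 + 1))).
Let E := Num.sqrt (\int[lam]_(x in cube M) (p x ^+ 2) +
  \sum_i \int[lam]_(x in cube M) (partial i p x ^+ 2)).

Let r0 : 0 < r. Proof. by rewrite (lt_le_trans ltr01). Qed.
Let M0 : 0 < M. Proof. by rewrite mulr_gt0. Qed.

(** Folding is the identity where [eta] is nonzero, so this is the piece eta p; writing it with F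
    lets [fold_test] treat both pieces. *)
Let eta_bound : `|sintegral nu setT (fun x => eta x * p (F x))| <= C * E.
Proof.
apply: (@fold_test R d M (4 * r) 2 B0 B1 eta p) => //.
- by have := r0; lra.
- by move=> x; rewrite ger0_norm ?cutoff_ge0// cutoff_le1.
- move=> x y; rewrite (le_trans (cutoff_lip r1 _ _ _))//.
  by rewrite mulr_natl mulr2n lerDl.
- by move=> x xr; rewrite (@cutoff_0 R d r r1) ?mul0r//; have := r0; move: xr; lra.
Qed.

Let zeta_bound : `|sintegral nu setT (fun x => `|zeta x * p (F x)|)| <= C * E.
Proof.
apply: (@fold_test R d M (4 * r) 2 B0 B1 zeta p) => //.
- by have := r0; lra.
- move=> x; have := @cutoff_ge0 R d r 2 x; have := @cutoff_le1 R d r 4 x.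
  have : cutoff r 2 x <= cutoff r 4 x by apply: cutoff_le; lra.
  by rewrite ler_norml => *; apply/andP; split; lra.
- move=> x y; have := cutoff_lip r1 2 x y; have := cutoff_lip r1 4 x y.
  rewrite !ler_norml => /andP[? ?] /andP[? ?]; apply/andP; split; lra.
- by move=> x y; exact: ler_dist_dist.
- move=> x xr; rewrite !(@cutoff_0 R d r r1) ?subrr ?mul0r ?normr0//; have := r0; move: xr; lra.
Qed.

Let cF (g : 'rV[R]_d -> R) : measurable_fun setT (g : borel_rV R d -> R) ->
  measurable_fun setT (fun x : borel_rV R d => g x * p (F x)).
Proof.
move=> mg; apply: measurable_funM => //.
apply: (@measurableT_comp _ _ _ _ _ _ (p : borel_rV R d -> R) _ (F : borel_rV R d -> borel_rV R d)).
  by apply: continuous_borel; exact: (lip_continuous B10 (fun i => line_lipschitz (@dp i) (dpB i))).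
exact: measurable_fold.
Qed.

Let mcut k : measurable_fun setT (cutoff r k : borel_rV R d -> R).
Proof.
apply: measurable_maxr => //; apply: measurable_minr => //; apply: measurable_funB => //.
by apply: measurable_funM => //; exact: measurable_norm_rV.
Qed.

Let a x := eta x * p (F x).
Let w x := zeta x * p (F x).
Let wQ : borel_rV R d -> R := w \_ (cube M).

Let zeta01 x : 0 <= zeta x <= 1.
Proof.
have := @cutoff_ge0 R d r 2 x; have := @cutoff_le1 R d r 4 x.
have : cutoff r 2 x <= cutoff r 4 x by apply: cutoff_le; lra.
by move=> *; apply/andP; split; lra.
Qed.

Let wB x : `|w x| <= B0.
Proof.
have /andP[? ?] := zeta01 x.
by rewrite /w normrM (ger0_norm (_ : 0 <= zeta x))// (le_trans (ler_piMl _ _)).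
Qed.

Let aB x : `|a x| <= B0.
Proof.
by rewrite /a normrM (ger0_norm (cutoff_ge0 _ _ _)) (le_trans (ler_piMl _ _))// cutoff_le1.
Qed.

Let w_out x : 4 * r < `|x| -> w x = 0.
Proof.
move=> xr; rewrite /w !(@cutoff_0 R d r r1) ?subrr ?mul0r//; have := r0; move: xr; lra.
Qed.

Let a_out x : 4 * r < `|x| -> a x = 0.
Proof.
move=> xr; rewrite /a (@cutoff_0 R d r r1) ?mul0r//; have := r0; move: xr; lra.
Qed.

Let w_K x : K x -> w x = 0.
Proof.
move=> /Kr xr; rewrite /w !(@cutoff_1 R d r r1) ?subrr ?mul0r//;
  by apply: le_trans xr _; have := r0; lra.
Qed.

Let wQE x : wQ x = w x \/ wQ x = 0.
Proof. by rewrite /wQ patchE; case: ifP; [left|right]. Qed.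

Let pE x : (p \_ (cube M)) x = a x + wQ x.
Proof.
rewrite /wQ !patchE; case: ifPn => [|]; rewrite ?inE ?notin_setE /cube/=.
  move=> xM; rewrite /a /w (fold_id M0)// (@cutoff_1 R d r r1 4); first by ring.
  by apply: le_trans xM _; lra.
move=> /negP; rewrite -ltNge => xM; rewrite /a (@cutoff_0 R d r r1) ?mul0r ?addr0//.
by have := r0; move: xM; lra.
Qed.

Let ma : measurable_fun setT (a : borel_rV R d -> R).
Proof. exact: cF. Qed.

Let mw : measurable_fun setT (w : borel_rV R d -> R).
Proof. by apply: cF; apply: measurable_funB. Qed.

Let mwQ : measurable_fun setT wQ.
Proof. by apply/(measurable_restrictT _ _).1 => //; exact: measurable_funS mw. Qed.

Let wQB x : `|wQ x| <= B0.
Proof. by have [->|->] := wQE x; rewrite ?wB ?normr0. Qed.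

Let wQ_out (x : 'rV_d) : 4 * r < `|x| -> wQ x = 0.
Proof. by have [->|->] := wQE x => // /w_out. Qed.

Let mb : measurable_fun setT ((fun x => `|w x|) : borel_rV R d -> R).
Proof. exact: measurableT_comp. Qed.

Section integrability.
Variable mu : {measure set (borel_rV R d) -> \bar R}.
Hypothesis muoo : locally_finite mu.

Let ia : mu.-integrable setT (EFin \o (a : borel_rV R d -> R)).
Proof. exact: (integrable_bounded_support muoo ma aB a_out). Qed.

Let iwQ : mu.-integrable setT (EFin \o wQ).
Proof. exact: (integrable_bounded_support muoo mwQ wQB wQ_out). Qed.

Let ib : mu.-integrable setT (EFin \o ((fun x => `|w x|) : borel_rV R d -> R)).
Proof.
apply: (@integrable_bounded_support R d mu _ B0 (4 * r) muoo mb) => x.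
  by rewrite normr_id.
by move=> /w_out ->; rewrite normr0.
Qed.

Lemma pairing_split : [/\
  \int[mu]_(x in cube M) p x = \int[mu]_x a x + \int[mu]_x wQ x,
  \int[mu]_x (`|w x| - wQ x) = \int[mu]_x `|w x| - \int[mu]_x wQ x &
  \int[mu]_x (`|w x| + wQ x) = \int[mu]_x `|w x| + \int[mu]_x wQ x].
Proof.
split; [|exact: RintegralB|exact: RintegralD].
rewrite Rintegral_mkcond -RintegralD//.
by apply: eq_Rintegral => x _; exact: pE.
Qed.

End integrability.

(* With w = zeta p(F), both |w| - w 1_Q and |w| + w 1_Q are nonnegative and vanish
   on K, so the sign of nu off K bounds the pairing of w 1_Q by that of |w|, which
   is compactly supported and Lipschitz although w 1_Q jumps across the boundary. *)
Lemma fold_pairing_bound : `|sintegral nu (cube M) p| <= 2 * (C * E).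
Proof.
have key (mu1 mu2 : {measure set (borel_rV R d) -> \bar R}) : locally_finite mu1 -> locally_finite mu2 ->
    (forall B : set (borel_rV R d), measurable B -> B `<=` ~` K -> (mu2 B <= mu1 B)%E) ->
    `|\int[mu1]_x wQ x - \int[mu2]_x wQ x| <= \int[mu1]_x `|w x| - \int[mu2]_x `|w x|.
  move=> oo1 oo2 mu12.
  have le (s : R) : `|s| <= 1 -> \int[mu2]_x (`|w x| + s * wQ x) <= \int[mu1]_x (`|w x| + s * wQ x).
    move=> s1; have sw x : `|s * wQ x| <= `|w x|.
      rewrite normrM (le_trans (ler_piMl _ _))//.
      by have [->|->] := wQE x; rewrite ?normr0.
    apply: (@le_Rintegral_measure R d mu1 mu2 K _ (2 * B0) (4 * r) oo1 oo2 (@cK) mu12).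
    - by apply: measurable_funD => //; exact: measurable_funM.
    - move=> x; have := sw x; rewrite ler_norml => /andP[? ?]; have ? := wB x.
      by apply/andP; split; lra.
    - by move=> x xr; rewrite (w_out xr) (wQ_out xr) mulr0 normr0 addr0.
    - move=> x Kx; have := sw x; rewrite (w_K Kx) normr0 normr_le0 => /eqP ->.
      by rewrite addr0.
  have [_ B1' D1] := pairing_split oo1; have [_ B2' D2] := pairing_split oo2.
  have lB : \int[mu2]_x (`|w x| - wQ x) <= \int[mu1]_x (`|w x| - wQ x).
    have := le (-1); rewrite normrN1 lexx => /(_ isT).
    rewrite (_ : (fun x => `|w x| + -1 * wQ x) = (fun x => `|w x| - wQ x))//.
    by apply/funext => x; rewrite mulN1r.
  have lD : \int[mu2]_x (`|w x| + wQ x) <= \int[mu1]_x (`|w x| + wQ x).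
    have := le 1; rewrite normr1 lexx => /(_ isT).
    rewrite (_ : (fun x => `|w x| + 1 * wQ x) = (fun x => `|w x| + wQ x))//.
    by apply/funext => x; rewrite mul1r.
  move: lB lD; rewrite B1' B2' D1 D2 ler_norml => ? ?; apply/andP; split; lra.
have oop := @spos_lty _ _ nu; have oon := @sneg_lty _ _ nu.
have [Ep _ _] := pairing_split oop; have [En _ _] := pairing_split oon.
move: eta_bound zeta_bound; rewrite /sintegral Ep En -/a -/w.
have : `|\int[spos nu]_x wQ x - \int[sneg nu]_x wQ x| <=
    `|\int[spos nu]_x `|w x| - \int[sneg nu]_x `|w x| |.
  case: nuK => h; last by rewrite (le_trans (key _ _ oop oon h))// ler_norm.
  by rewrite distrC (le_trans (key _ _ oon oop h))// (le_trans (ler_norm _))// distrC.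
move=> h1 h2 h3.
rewrite opprD addrACA (le_trans (ler_normD _ _))// mulr_natl mulr2n lerD//.
exact: le_trans h3.
Qed.

End signed_outside.

(** * Approximation in H^1 of a cube *)

Section approximation.
Context {R : realType} {d : nat}.
Local Notation lam := (@lebesgue_rV R d).
Local Notation e_ i := (delta_mx 0 i : 'rV[R]_d).

(** Heine-Cantor, by the near-covering form of compactness applied to the filter of t tending to 0
    from the right. *)
Lemma uniformly_continuous_compact (Q : set 'rV[R]_d) (f : 'rV[R]_d -> R) :
  compact Q -> {within Q, continuous f} -> forall e, 0 < e ->
  exists2 t, 0 < t & forall x y, Q x -> Q y -> `|x - y| < t -> `|f x - f y| <= e.
Proof.
move=> cQ cf e e0.
have /compact_near_coveringP H := cQ.
have near0 : \forall t \near (0 : R)^'+, Q `<=` [set x | Q x -> forall y, Q y -> `|x - y| < t -> `|f x - f y| <= e].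
  apply: (H R (0 : R)^'+ (fun t x => Q x -> forall y, Q y -> `|x - y| < t -> `|f x - f y| <= e)) => x Qx.
  have e20 : 0 < e / 2 by rewrite divr_gt0.
  have [s s0 Hs] : exists2 s, 0 < s & forall y, Q y -> `|x - y| < s -> `|f x - f y| <= e / 2.
    move/subspace_continuousP : cf => /(_ x Qx) /cvgrPdist_le /(_ _ e20).
    rewrite near_withinE => /nbhs_ballP[s /= s0 xs].
    exists s => // y Qy xy; apply: xs => //; by rewrite -ball_normE.
  have s20 : 0 < s / 2 by rewrite divr_gt0.
  exists (ball x (s / 2), [set t : R | t < s / 2]).
    split; first exact: nbhsx_ballx.
    by apply: nbhs_right_lt.
  move=> [x' t] /= [xx' ts] Qx' y Qy x'y.
  have {}xx' : `|x - x'| < s / 2 by move: xx'; rewrite -ball_normE.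
  have h1 := Hs x' Qx'; have h2 := Hs y Qy.
  have xy : `|x - y| < s.
    by rewrite (le_lt_trans (ler_distD x' _ _))//; move: xx' x'y ts; lra.
  have {}h1 : `|f x - f x'| <= e / 2 by apply: h1; move: xx'; lra.
  rewrite (le_trans (ler_distD (f x) _ _))// distrC; have := h2 xy; lra.
have [t [t0 Ht]] : exists t : R, 0 < t /\ Q `<=` [set x | Q x -> forall y, Q y -> `|x - y| < t -> `|f x - f y| <= e].
  near (0 : R)^'+ => t; exists t; split => //; near: t; exact: near0.
by exists t => // x y Qx; exact: Ht.
Unshelve. all: by end_near. Qed.

Lemma is_derive_reflect (k : 'rV[R]_d -> R) z i (y : 'rV[R]_d) : derivable k (z - y) (e_ i) ->
  is_derive y (e_ i) (fun y => k (z - y)) (- partial i k (z - y)).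
Proof.
move=> df; have := @is_derive_line R d k (e_ i) (z - y) 0; rewrite scale0r add0r => /(_ df) dl.
have E : (fun h : R => k (z - (h *: e_ i + y))) = (fun s => k (s *: e_ i + (z - y))) \o -%R.
  by apply/funext => h /=; rewrite opprD scaleNr addrCA.
have dN := @is_deriveNid R R 0 1; rewrite -[0 in X in is_derive X _ (fun s => _) _]oppr0 in dl.
have := is_derive1_comp dl dN; rewrite -E mulrN1 => -[dE vE].
have dd : derivable (fun y => k (z - y)) y (e_ i) by apply/derivable1P.
split=> //; rewrite -vE.
have := @is_derive_line R d (fun y => k (z - y)) (e_ i) y 0.
by rewrite scale0r add0r => /(_ dd) [_ ->].
Qed.

Lemma smooth_reflect (k : 'rV[R]_d -> R) z : smooth k -> smooth (fun y => k (z - y)).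
Proof.
have D f i (y : 'rV[R]_d) := @is_derive_reflect f z i y.
suff H n f : smooth f -> Ck n (fun y => f (z - y)) by move=> sk n; exact: H.
elim: n f => [|n IH] f sf; first by apply/Ck0/continuous_shift; exact: smooth_continuous.
apply/CkS; split; first by apply: continuous_shift; exact: smooth_continuous.
move=> i; split=> [y|]; first by have [] := D f i y (@smooth_derivable R d f i _ sf).
rewrite (_ : partial i _ = fun y => -1 * partial i f (z - y)).
  by apply: Ck_cstM; apply: IH; exact: smooth_partial.
apply/funext => y; rewrite mulN1r.
by have [_ vD] := D f i y (@smooth_derivable R d f i _ sf); exact: vD.
Qed.

Lemma ge0_integral_dilate (a : R) (h : borel_rV R d -> \bar R) : 0 < a ->
  measurable_fun setT h -> (forall x, 0 <= h x)%E ->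
  (\int[lam]_x h x = (a ^+ d)%:E * \int[lam]_x h (a *: (x : 'rV_d)))%E.
Proof.
move=> a0 mh h0; rewrite (@ge0_integral_affine_rV R d (fun=> a) (fun=> 0))//; last first.
  by move=> _; rewrite gt_eqF.
rewrite prodr_const card_ord gtr0_norm//; congr (_ * _)%E.
by apply: eq_integral => x _; congr h; apply/rowP => i; rewrite !mxE addr0.
Qed.

Lemma is_derive_dilate (q : 'rV[R]_d -> R) (a : R) i x : (forall x, derivable q x (e_ i)) ->
  is_derive x (e_ i) (fun x => q (a *: x)) (a * partial i q (a *: x)).
Proof.
move=> dq; have := @is_derive_line R d q (e_ i) (a *: x) 0 (dq _).
rewrite scale0r add0r => dl.
have E : (fun h : R => q (a *: (h *: e_ i + x))) = (fun s => q (s *: e_ i + a *: x)) \o ( *%R a).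
  by apply/funext => h /=; rewrite scalerDr scalerA.
have dN : is_derive (0 : R) (1 : R) ( *%R a) a.
  have := @is_deriveZ R R R id a 0 1 1 (is_derive_id _ _).
  by rewrite [_ *: _]mulr1.
have dl' : is_derive (a * 0) (1 : R) (fun s : R => q (s *: e_ i + a *: x)) ('D_(e_ i) q (a *: x)).
  by rewrite mulr0.
have := is_derive1_comp dl' dN; rewrite -E mulrC => -[dE vE].
have dd : derivable (fun y => q (a *: y)) x (e_ i) by apply/derivable1P.
split=> //; rewrite -vE.
have := @is_derive_line R d (fun y => q (a *: y)) (e_ i) x 0.
by rewrite scale0r add0r => /(_ dd) [_ ->].
Qed.

Lemma interior_cube (M : R) (x : 'rV[R]_d) : `|x| < M -> (cube M)° x.
Proof.
move=> xM; apply/nbhs_ballP; exists (M - `|x|); first by rewrite /= subr_gt0.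
move=> y; rewrite -ball_normE /= => xy; rewrite /cube/=.
rewrite -(subrK x y) (le_trans (ler_normD _ _))// distrC; move: xy; lra.
Qed.

Variables (M : R) (f : 'rV[R]_d -> R) (G : 'I_d -> 'rV[R]_d -> R).
Hypotheses (M0 : 0 < M) (cf : {within cube M, continuous f}) (hf : H1 (cube M)° f G).

Local Notation U := ((cube M)° : set 'rV[R]_d).
Let g : borel_rV R d -> R := f \_ U.
Let gG i : borel_rV R d -> R := G i \_ U.

Let mU : measurable (U : set (borel_rV R d)).
Proof. by apply: open_borel; exact: open_interior. Qed.

Let UQ x : U x -> cube M x.
Proof. exact: interior_subset. Qed.

Let loo : (lam U < +oo)%E.
Proof.
apply: (le_lt_trans _ (lebesgue_rV_locally_finite (@compact_cube R d M))).
by apply: le_measure; rewrite ?inE//; exact: measurable_cube.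
Qed.

Let restr_L2 (h : borel_rV R d -> R) : L2 U h ->
  lam.-integrable setT (EFin \o (h \_ U)) /\
  (\int[lam]_x ((h \_ U) x ^+ 2)%:E = (\int[lam]_(x in U) (h x ^+ 2))%:E)%E.
Proof.
move=> [mh ih]; split.
  rewrite -restrict_EFin; apply/(integrable_mkcond _ mU).1.
  (* U has finite measure and |h| <= 1 + h^2, so square-integrable functions on U are integrable and
     may be convolved. *)
  have i1 : lam.-integrable U (EFin \o (fun=> 1 : R)).
    by apply: measurable_bounded_integrable => //; exact: bounded_cst.
  have i2 := integrableD mU i1 ih.
  apply: (le_integrable _ _ _ i2) => //; first exact/measurable_EFinP.
  move=> x _ /=; rewrite lee_fin [leRHS]ger0_norm ?addr_ge0 ?sqr_ge0//.
  rewrite ler_norml; apply/andP; split; nra.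
rewrite fineK; last exact: integrable_fin_num ih.
rewrite [RHS]integral_mkcond; apply: eq_integral => x _.
by rewrite !patchE; case: ifP; rewrite ?expr0n.
Qed.

Let L2f : L2 U f. Proof. by have [] := hf. Qed.
Let L2G i : L2 U (G i). Proof. by have [_ ? _] := hf. Qed.
Let ig : lam.-integrable setT (EFin \o g). Proof. exact: (restr_L2 L2f).1. Qed.
Let igG i : lam.-integrable setT (EFin \o gG i). Proof. exact: (restr_L2 (L2G i)).1. Qed.

(** Undoing the dilation costs a^(-d) <= 2^d, and mollification does not increase the L^2 norm. It
    is used with c = 1 for p and with c = a, the factor of the chain rule, for its partials. *)
Let dilate_energy (e a c : R) rho (k k' : borel_rV R d -> R) : is_mollifier e rho ->
  1 / 2 <= a -> `|c| <= 1 -> L2 U k ->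
  measurable_fun setT k' -> (forall x, cube M x -> k' x = c * conv rho (k \_ U) (a *: (x : 'rV_d))) ->
  \int[lam]_(x in cube M) (k' x ^+ 2) <= 2 ^+ d * \int[lam]_(x in U) (k x ^+ 2).
Proof.
move=> mrho a2 c1 L2k mk' k'E; have [ik Ik] := restr_L2 L2k.
have a0 : 0 < a by rewrite (lt_le_trans _ a2)// divr_gt0.
pose h (x : borel_rV R d) : \bar R := ((conv rho (k \_ U) x) ^+ 2)%:E.
have cc : continuous (conv rho (k \_ U)) by apply: conv_continuous => //; exact: (mollifier_ccsmooth mrho).
have mh : measurable_fun setT h.
  by apply/measurable_EFinP; apply: measurable_funX; exact: (continuous_borel cc).
have mha : measurable_fun setT (fun x : borel_rV R d => h (a *: (x : 'rV_d))).
  apply/measurable_EFinP; apply: measurable_funX.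
  apply: (@continuous_borel R d (fun x => conv rho (k \_ U) (a *: x))) => x.
  by apply: (@continuous_comp _ _ _ (fun x : 'rV[R]_d => a *: x : 'rV[R]_d) (conv rho (k \_ U)));
    [exact: scaler_continuous|exact: cc].
have h0 x : (0 <= h x)%E by rewrite lee_fin sqr_ge0.
have main : (\int[lam]_x h (a *: (x : 'rV_d)) <= (2 ^+ d * \int[lam]_(x in U) (k x ^+ 2))%:E)%E.
  have hle : (\int[lam]_x h x <= (\int[lam]_(x in U) (k x ^+ 2))%:E)%E.
    by rewrite -Ik; exact: (young_mollifier mrho ik).
  have I0 : (0 <= \int[lam]_x h (a *: (x : 'rV_d)))%E by apply: integral_ge0.
  apply: (@le_trans _ _ ((2 ^+ d)%:E * \int[lam]_x h x)%E); last first.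
    by rewrite EFinM lee_pmul2l ?lte_fin ?exprn_gt0.
  rewrite (ge0_integral_dilate a0 mh h0) muleA -EFinM -exprMn lee_pemull// lee_fin exprn_ege1//.
  by move: a2; rewrite ler_pdivrMr// mulrC.
have fin : (\int[lam]_(x in cube M) (k' x ^+ 2)%:E <= (2 ^+ d * \int[lam]_(x in U) (k x ^+ 2))%:E)%E.
  apply: le_trans main.
  apply: (@le_trans _ _ (\int[lam]_(x in cube M) h (a *: (x : 'rV_d)))%E); last first.
    exact: ge0_subset_integral.
  apply: ge0_le_integral => //.
  - by move=> x _; rewrite lee_fin sqr_ge0.
  - apply: measurable_funTS; apply/measurable_EFinP; exact: measurable_funX.
  - exact: measurable_funTS mha.
  move=> x Qx; rewrite lee_fin (k'E x Qx) exprMn ler_piMl ?sqr_ge0//.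
  by rewrite -real_normK ?num_real// exprn_ile1.
rewrite -lee_fin fineK//; apply/fin_numPlt/andP; split.
  by rewrite (lt_le_trans (ltNyr 0))// integral_ge0// => x _; rewrite lee_fin sqr_ge0.
by rewrite (le_lt_trans fin)// ltry.
Qed.

(** When |z| + e < M, the function rho(z - y) of y is a test function on U, and the weak derivative
    can be tested against it. Closer to the boundary the jump of the extension by zero would
    contribute. *)
Let weak_conv (e : R) rho z i : is_mollifier e rho -> `|z| + e < M ->
  conv (partial i rho) g z = conv rho (gG i) z.
Proof.
move=> mrho zeM; have srho := mollifier_ccsmooth mrho; have [sr _] := srho.
have [_ _ wG] := hf.
pose phi (y : 'rV[R]_d) := rho (z - y).
have tphi : test_fun U phi.
  have sub : [set y | phi y != 0] `<=` cube (`|z| + e).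
    move=> y /= phiy; rewrite /cube/= leNgt; apply/negP => zy; move: phiy; rewrite /phi.
    have h : e <= `|z - y| by rewrite distrC (le_trans _ (lerB_dist _ _))// lerBrDl ltW.
    by have [_ _ /(_ _ h) -> _] := mrho; rewrite eqxx.
  have csub : closure [set y | phi y != 0] `<=` cube (`|z| + e).
    have /closure_id -> := @closed_cube R d (`|z| + e).
    exact: closure_subset.
  split; first exact: smooth_reflect.
    by apply: (subclosed_compact _ (@compact_cube R d _) csub); exact: closed_closure.
  by move=> y /csub; rewrite /cube/= => ?; apply: interior_cube; exact: le_lt_trans zeM.
have phiE y : partial i phi y = - partial i rho (z - y).
  have dr := @smooth_derivable R d rho i (z - y) sr.
  by have [_ E] := is_derive_reflect dr; exact: E.
have [B _ rB] := ccsmooth_bounded (ccsmooth_partial i srho).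
have iU : lam.-integrable U (EFin \o (fun y => partial i rho (z - y) * f y)).
  apply/(integrable_mkcond _ mU).2.
  have := integrable_conv z (smooth_continuous (smooth_partial i sr)) rB ig.
  rewrite restrict_EFin; apply: eq_integrable => // y _ /=.
  by rewrite /g !patchE; case: ifP; rewrite ?mulr0.
rewrite /conv.
transitivity (\int[lam]_(y in U) (partial i rho (z - y) * f y)).
  rewrite [RHS]Rintegral_mkcond; apply: eq_Rintegral => y _.
  by rewrite /g !patchE; case: ifP; rewrite ?mulr0.
transitivity (- \int[lam]_(y in U) (f y * partial i phi y)).
  rewrite -mulN1r -RintegralZl//.
    by apply: eq_Rintegral => y _; rewrite phiE; ring.
  have := integrableZl mU (-1) iU; apply: eq_integrable => // y _ /=.
  by rewrite -EFinM phiE; congr EFin; ring.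
rewrite (wG i phi tphi) opprK [LHS]Rintegral_mkcond; apply: eq_Rintegral => y _.
by rewrite /gG !patchE; case: ifP; rewrite ?mulr0// mulrC.
Qed.

(** Uniform closeness on all of the closed cube is for the pairing with nu; for the energy a bound
    up to the factor 2^d suffices. The bounds [B0] and [B1] only make p admissible for
    [fold_pairing_bound] and enter no constant. *)
Lemma H1_approx (del : R) : 0 < del -> exists (p : 'rV[R]_d -> R) (B0 B1 : R),
  [/\ 0 <= B0, 0 <= B1, forall i (x : 'rV[R]_d), derivable p x (e_ i), forall x, `|p x| <= B0 &
      forall i x, `|partial i p x| <= B1] /\
  [/\ forall i, continuous (partial i p),
      forall x, cube M x -> `|p x - f x| <= del &
      \int[lam]_(x in cube M) (p x ^+ 2) + \sum_i \int[lam]_(x in cube M) (partial i p x ^+ 2) <=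
      2 ^+ d * H1norm U f G ^+ 2].
Proof.
move=> del0.
have [t t0 ft] := uniformly_continuous_compact (@compact_cube R d M) cf del0.
(* The dilation by a = 1 - s/M brings the cube to distance s from its boundary, twice the
   mollification radius s/2. From s <= M/2 follows a >= 1/2; from s <= t/2, each y seen by the
   average satisfies |y - x| < 3s/2 < t. *)
pose s := Num.min (M / 2) (t / 2).
have s0 : 0 < s by rewrite lt_min !divr_gt0.
have sM : s <= M / 2 by rewrite ge_min lexx.
have st : s <= t / 2 by rewrite ge_min lexx orbT.
pose a := 1 - s / M.
have aM : a * M = M - s by rewrite /a mulrBl mul1r divfK ?gt_eqF.
have a2 : 1 / 2 <= a.
  by rewrite /a lerBrDr -lerBrDl ler_pdivrMr//; move: sM; lra.
have a1 : a <= 1 by rewrite /a gerBl divr_ge0// ltW.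
have a0 : 0 < a by rewrite (lt_le_trans _ a2)// divr_gt0.
have e0 : 0 < s / 2 by rewrite divr_gt0.
have [rho mrho] := @mollifier R d (s / 2) e0.
have srho := mollifier_ccsmooth mrho.
pose q := conv rho g.
have sq : ccsmooth q.
  split; first exact: conv_smooth.
  exists (s / 2 + M) => x; apply: conv_eq0.
    by move=> z /ltW; have [_ _ + _] := mrho; apply.
  move=> z Mz; rewrite /g patchE memNset//= => /UQ; rewrite /cube/= leNgt Mz.
  by [].
have [B0 B00 qB] := ccsmooth_bounded sq.
have [B1 B10 qB1] := ccsmooth_partial_bounded sq.
have dq i (x : 'rV[R]_d) : derivable q x (e_ i) by exact: (@smooth_derivable R d q i x sq.1).
pose p (x : 'rV[R]_d) := q (a *: x).
have dp i x := is_derive_dilate a x (dq i).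
have pE i x : partial i p x = a * partial i q (a *: x) by have [_ E] := dp i x; exact: E.
have Qa (x : 'rV[R]_d) : cube M x -> `|a *: x| <= M - s.
  by move=> xM; rewrite normrZ (gtr0_norm a0) -aM ler_wpM2l// ltW.
have cdil (k : 'rV[R]_d -> R) : continuous k -> continuous (fun x : 'rV[R]_d => k (a *: x)).
  move=> ck x; apply: (@continuous_comp _ _ _ (fun x : 'rV[R]_d => a *: x : 'rV[R]_d) k);
    [exact: scaler_continuous|exact: ck].
have cq : continuous q by exact: (smooth_continuous sq.1).
have cqi i : continuous (partial i q) by exact: (smooth_continuous (smooth_partial i sq.1)).
have cpi i : continuous (partial i p).
  rewrite (_ : partial i p = fun x => a * partial i q (a *: x)); last by apply/funext => x; exact: pE.
  move=> x; exact: (@continuousM _ _ (cst a) (fun x : 'rV[R]_d => partial i q (a *: x)) x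
    (@cst_continuous 'rV[R]_d R a x) (cdil _ (cqi i) x)).
exists p, B0, B1; split; split.
- exact: B00.
- exact: B10.
- by move=> i x; have [] := dp i x.
- by move=> x; exact: qB.
- by move=> i x; rewrite pE normrM (gtr0_norm a0) (le_trans (ler_piMl _ _)).
- exact: cpi.
- move=> x Qx; apply: (conv_approx mrho ig) => y xy.
  have yM : `|y| < M.
    have := Qa x Qx; have := lerB_dist y (a *: x); rewrite distrC; move: xy s0; lra.
  rewrite /g patchE mem_set; last exact: interior_cube.
  apply: ft => //; first by rewrite /cube/= ltW.
  have : `|a *: x - x| <= s.
    have -> : a *: x - x = (- (s / M)) *: x.
      by rewrite /a scalerBl scale1r scaleNr addrAC subrr add0r.
    rewrite normrZ normrN ger0_norm; last by rewrite divr_ge0// ltW.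
    rewrite -[leRHS](divfK (lt0r_neq0 M0)) ler_wpM2l//.
    by rewrite divr_ge0// ltW.
  have := ler_distD (a *: x) y x; rewrite (distrC y (a *: x)); move: xy st s0 t0; lra.
rewrite /H1norm sqr_sqrtr; last first.
  apply: addr_ge0; first by apply: Rintegral_ge0 => x _; exact: sqr_ge0.
  by apply: sumr_ge0 => i _; apply: Rintegral_ge0 => x _; exact: sqr_ge0.
rewrite mulrDr lerD//.
  apply: (@dilate_energy (s / 2) a 1 rho f p mrho a2) => //; rewrite ?normr1//.
    by apply: (@continuous_borel R d p); exact: cdil.
  by move=> x _; rewrite mul1r.
rewrite mulr_sumr; apply: ler_sum => i _.
apply: (@dilate_energy (s / 2) a a rho (G i) (partial i p) mrho a2) => //.
- by rewrite (gtr0_norm a0).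
- exact: continuous_borel.
move=> x Qx; rewrite pE; congr (_ * _).
have [_ E] := conv_derive i (a *: x) srho ig.
rewrite [LHS](_ : _ = conv (partial i rho) g (a *: x)); last exact: E.
by apply: (weak_conv _ mrho); have := Qa x Qx; move: s0; lra.
Qed.

End approximation.

(** * From continuous functions to all of H^1 *)

Section H1_pairing.
Context {R : realType} {d : nat}.
Local Notation lam := (@lebesgue_rV R d).

Lemma measurable_within_continuous (Q : set 'rV[R]_d) (f : 'rV[R]_d -> R) : closed Q ->
  {within Q, continuous f} -> measurable_fun (Q : set (borel_rV R d)) (f : borel_rV R d -> R).
Proof.
move=> cQ /continuousP cf; apply: (measurability _ (RGenOpens.measurableE R)).
move=> _ [_ [a [b ->] <-]].
have oab : open `]a, b[%classic by exact: interval_open.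
have /open_subspaceP[V oV VQ] := cf _ oab.
rewrite (_ : _ `&` _ = V `&` Q); last first.
  by rewrite VQ setIC.
apply: measurableI; [exact: open_borel|exact: closed_borel].
Qed.

Lemma sintegral_srestr (nu : smeasure R d) (Q : set (borel_rV R d)) (mQ : measurable Q) (f : 'rV[R]_d -> R) :
  sintegral (srestr nu mQ) Q f = sintegral nu Q f.
Proof.
have E (mu : {measure set (borel_rV R d) -> \bar R}) :
    \int[mrestr mu mQ]_(x in Q) f x = \int[mu]_(x in Q) f x.
  rewrite /Rintegral; congr fine; apply: eq_measure_integral => A mA AQ.
  by rewrite /= /mrestr setIidl.
by rewrite /sintegral /= !E.
Qed.

Lemma sintegral_close (nu : smeasure R d) (M : R) (f p : 'rV[R]_d -> R) (e : R) : 0 <= e ->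
  {within cube M, continuous f} -> {within cube M, continuous p} ->
  (forall x, cube M x -> `|p x - f x| <= e) ->
  `|sintegral nu (cube M) f - sintegral nu (cube M) p| <=
  e * (fine (spos nu (cube M)) + fine (sneg nu (cube M))).
Proof.
move=> e0 cf cp pf.
have int (mu : {measure set (borel_rV R d) -> \bar R}) (h : 'rV[R]_d -> R) : locally_finite mu ->
    {within cube M, continuous h} -> mu.-integrable (cube M) (EFin \o (h : borel_rV R d -> R)).
  move=> muoo ch; apply: measurable_bounded_integrable => //.
  - by apply: muoo; exact: compact_cube.
  - by apply: measurable_within_continuous => //; exact: closed_cube.
  have /compact_bounded[B [_ hB]] := continuous_compact ch (@compact_cube R d M).
  exists B; split; first exact: num_real.
  by move=> N BN x Qx; apply: (hB N BN); exists x.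
have bd (mu : {measure set (borel_rV R d) -> \bar R}) : locally_finite mu ->
    `|\int[mu]_(x in cube M) f x - \int[mu]_(x in cube M) p x| <= e * fine (mu (cube M)).
  move=> muoo; have i_f := int mu f muoo cf; have ip := int mu p muoo cp.
  have ifp : mu.-integrable (cube M) (EFin \o (fun x : borel_rV R d => f x - p x)).
    by have := integrableB (measurable_cube M) i_f ip.
  rewrite -RintegralB// (le_trans (le_normr_Rintegral _ _))// -Rintegral_cst//.
  apply: le_Rintegral => //; first exact: integrable_norm.
    apply: measurable_bounded_integrable => //; last exact: bounded_cst.
    by apply: muoo; exact: compact_cube.
  by move=> x Qx; rewrite distrC; exact: pf.
have bp := bd _ (@spos_lty _ _ nu); have bn := bd _ (@sneg_lty _ _ nu).
rewrite mulrDr; move: bp bn; rewrite /sintegral !ler_norml => /andP[? ?] /andP[? ?].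
by apply/andP; split; lra.
Qed.

Lemma H1_pairing_bound (r : R) (K : set 'rV[R]_d) (nu : smeasure R d) (N : R)
    (f : 'rV[R]_d -> R) (G : 'I_d -> 'rV[R]_d -> R) :
  (0 < d)%N -> 1 <= r -> closed K -> K `<=` cube r -> 0 <= N ->
  (forall f, ccsmooth f -> `|sintegral nu setT f| <= N * L2norm_grad f) ->
  nonpos_on nu (~` K) \/ nonneg_on nu (~` K) ->
  {within cube (3 * r), continuous f} -> H1 (cube (3 * r))° f G ->
  `|sintegral nu (cube (3 * r)) f| <=
  2 * Num.sqrt ((3 ^ d * d)%:R * (2 * (2 ^+ 2 + 1))) * Num.sqrt (2 ^+ d) * N *
    H1norm (cube (3 * r))° f G.
Proof.
move=> d0 r1 cK Kr N0 HN nuK cf hf.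
have M0 : 0 < 3 * r by rewrite mulr_gt0// (lt_le_trans ltr01).
set A := Num.sqrt (_ * _); set A' := Num.sqrt _; set H := H1norm _ _ _.
have H0 : 0 <= H by exact: sqrtr_ge0.
(* This mass depends on nu, but it is fixed before the accuracy e / (C + 1) of p is chosen and drops
   out of the final bound. *)
pose C := fine (spos nu (cube (3 * r))) + fine (sneg nu (cube (3 * r))).
have C0 : 0 <= C by rewrite addr_ge0// fine_ge0.
apply/ler_addgt0Pr => e e0.
have e'0 : 0 < e / (C + 1) by rewrite divr_gt0// ltr_pwDr.
have [p [B0 [B1 [[B00 B10 dp pB dpB] [cdp pf Ep]]]]] := H1_approx M0 cf hf e'0.
have cp : continuous p.
  exact: (lip_continuous B10 (fun i => line_lipschitz (dp i) (dpB i))).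
have := fold_pairing_bound r1 cK Kr B00 B10 dp pB dpB cdp d0 N0 HN nuK.
set E := _ + _ in Ep *; rewrite -/A => hp.
have hE : Num.sqrt E <= A' * H.
  rewrite (le_trans (ler_wsqrtr Ep))// sqrtrM ?exprn_ge0//.
  by rewrite sqrtr_sqr ger0_norm.
have := sintegral_close nu (ltW e'0) cf (continuous_subspaceT cp) pf; rewrite -/C => hc.
have hc' : e / (C + 1) * C <= e.
  by rewrite -mulrA ler_piMr ?(ltW e0)// mulrC ler_pdivrMr ?mul1r ?lerDl// ltr_pwDr.
have hp' : 2 * (N * A * Num.sqrt E) <= 2 * A * A' * N * H.
  have -> : 2 * A * A' * N * H = 2 * (N * A * (A' * H)) by ring.
  by rewrite ler_wpM2l// ler_wpM2l// mulr_ge0// sqrtr_ge0.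
rewrite -(subrK (sintegral nu (cube (3 * r)) p) (sintegral _ _ _)) addrC.
apply: (le_trans (ler_normD _ _)); apply: lerD; first exact: le_trans hp hp'.
exact: le_trans hc hc'.
Qed.

(** A triangle inequality with constant 2, from a^2 <= 2 b^2 + 2 (a - b)^2 under the integral, that
    is (a - 2 b)^2 >= 0. It bounds the norms along a sequence converging to g. *)
Lemma H1normD_le U (f g : 'rV[R]_d -> R) (F G : 'I_d -> 'rV[R]_d -> R) :
  H1 U f F -> H1 U g G ->
  measurable (U : set (borel_rV R d)) ->
  H1norm U f F <= 2 * H1norm U g G + 2 * H1norm U (f \- g) (fun i => F i \- G i).
Proof.
move=> [L2f L2F _] [L2g L2G _] mU.
have iB (a b : 'rV[R]_d -> R) : L2 U a -> L2 U b -> lam.-integrable U (EFin \o (fun x => (a \- b) x ^+ 2)).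
  move=> [ma ia] [mb ib].
  have iab := integrableD mU (integrableZl mU 2 ia) (integrableZl mU 2 ib).
  apply: (le_integrable _ _ _ iab) => //.
    by apply/measurable_EFinP; apply: measurable_funX; exact: measurable_funB.
  move=> x _ /=; rewrite lee_fin ger0_norm ?sqr_ge0// [leRHS]ger0_norm.
    have := sqr_ge0 (a x + b x); nra.
  by apply: addr_ge0; rewrite mulr_ge0 ?sqr_ge0.
have le2 (a b : 'rV[R]_d -> R) : L2 U a -> L2 U b ->
    \int[lam]_(x in U) (a x ^+ 2) <= 2 * \int[lam]_(x in U) (b x ^+ 2) +
      2 * \int[lam]_(x in U) ((a \- b) x ^+ 2).
  move=> ha hb; have iab := iB _ _ ha hb; have [ma ia] := ha; have [mb ib] := hb.
  have i2 (h : 'rV[R]_d -> R) : lam.-integrable U (EFin \o (h : borel_rV R d -> R)) ->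
      lam.-integrable U (EFin \o (fun x : borel_rV R d => 2 * h x)).
    by move=> ih; have := integrableZl mU 2 ih; under eq_fun do rewrite /= -EFinM.
  rewrite -!RintegralZl// -RintegralD//; [|exact: i2|exact: i2].
  apply: le_Rintegral => //.
    by have := integrableD mU (i2 _ ib) (i2 _ iab).
  move=> x _ /=; have := sqr_ge0 (a x - 2 * b x); nra.
have pos (a : 'rV[R]_d -> R) : 0 <= \int[lam]_(x in U) (a x ^+ 2).
  by apply: Rintegral_ge0 => x _; exact: sqr_ge0.
have spos' (a : 'I_d -> 'rV[R]_d -> R) : 0 <= \sum_i \int[lam]_(x in U) (a i x ^+ 2).
  by apply: sumr_ge0.
rewrite -mulrDr -[leRHS]ger0_norm ?mulr_ge0 ?addr_ge0 ?sqrtr_ge0// -sqrtr_sqr.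
apply: ler_wsqrtr.
have h1 := le2 _ _ L2f L2g.
have h2 : \sum_i \int[lam]_(x in U) (F i x ^+ 2) <= 2 * (\sum_i \int[lam]_(x in U) (G i x ^+ 2)) +
    2 * \sum_i \int[lam]_(x in U) ((F i \- G i) x ^+ 2).
  by rewrite !mulr_sumr -big_split; apply: ler_sum => i _; exact: le2.
have g1 := pos g; have g2 := spos' G; have g3 := pos (f \- g); have g4 := spos' (fun i => F i \- G i).
set x := H1norm U g G; set y := H1norm U _ _.
have xy : 0 <= x * y by rewrite mulr_ge0// sqrtr_ge0.
have ex : x ^+ 2 = \int[lam]_(x in U) (g x ^+ 2) + \sum_i \int[lam]_(x in U) (G i x ^+ 2).
  by rewrite sqr_sqrtr// addr_ge0.
have ey : y ^+ 2 = \int[lam]_(x in U) ((f \- g) x ^+ 2) + \sum_i \int[lam]_(x in U) ((F i \- G i) x ^+ 2).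
  by rewrite sqr_sqrtr// addr_ge0.
have -> : (2 * (x + y)) ^+ 2 = 4 * x ^+ 2 + 8 * (x * y) + 4 * y ^+ 2 by ring.
rewrite ex ey; lra.
Qed.

End H1_pairing.

Theorem proposition6p4 (R : realType) (d : nat) (hd : (2 <= d)%N)
    (K : set 'rV[R]_d) (cK : compact K) (bK : C2_boundary K) :
  exists (K1 : set 'rV[R]_d) (cK1 : compact K1) (c : R),
    [/\ K `<=` K1, 0 < c &
        forall nu : smeasure R d, (normHm1 nu < +oo)%E ->
          nonpos_on nu (~` K) \/ nonneg_on nu (~` K) ->
          (c%:E * normHm1_on K1 (srestr nu (compact_borel cK1))
             <= normHm1 nu)%E].
Proof.
have d0 : (0 < d)%N by apply: leq_trans hd.
have [r r1 Kr] := compact_sub_cube cK.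
have r0 : 0 < r by rewrite (lt_le_trans ltr01).
(* The factor 2 counts the two pieces of p, the first root comes from [fold_test] with T = 2, and
   the second from the dilation in [H1_approx]. *)
pose A := 2 * Num.sqrt ((3 ^ d * d)%:R * (2 * (2 ^+ 2 + 1))) * Num.sqrt (2 ^+ d) : R.
have A0 : 0 <= A by rewrite !mulr_ge0 ?sqrtr_ge0.
(* The factor 2 is lost in [H1normD_le]; adding 1 makes the denominator of c positive at once. *)
have B0 : 0 < 2 * A + 1 by rewrite ltr_pwDr// mulr_ge0.
exists (cube (3 * r)), (@compact_cube R d (3 * r)), (2 * A + 1)^-1; split.
- by move=> x /Kr xr; apply: le_trans xr _; lra.
- by rewrite invr_gt0.
move=> nu nuoo nuK; have [N [N0 NE HN]] := normHm1_dual d0 nuoo.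
have -> : normHm1 nu = ((2 * A + 1)^-1%:E * ((2 * A + 1) * N)%:E)%E.
  by rewrite NE -EFinM mulKf// lt0r_neq0.
rewrite lee_pmul2l//; last by rewrite lte_fin invr_gt0.
apply: ub_ereal_sup => _ [f [G [l [hf Hn0 [f_ [G_ [hf_ Hcvg lcvg]]] ->]]]].
set U := (cube (3 * r))°; set H := H1norm U f G in Hn0 *.
have mU : measurable (U : set (borel_rV R d)) by apply: open_borel; exact: open_interior.
have H0 : 0 < H by rewrite lt_neqAle eq_sym Hn0 sqrtr_ge0.
suff h : l <= 2 * A * N * H.
  rewrite lee_fin ler_pdivrMr// (le_trans h)// ler_wpM2r ?(ltW H0)// ler_wpM2r//.
  by rewrite lerDl.
(* A bound for the pairing with the continuous [f_ n], whose limit is a multiple of the norm of f;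
   the inequality then passes to the limit l. *)
pose b n := A * N * (2 * H + 2 * H1norm U (f_ n \- f) (fun i => G_ n i \- G i)).
have bcvg : b @ \oo --> 2 * A * N * H.
  have -> : 2 * A * N * H = A * N * (2 * H + 2 * 0) by ring.
  apply: cvgM; first exact: cvg_cst.
  apply: cvgD; first exact: cvg_cst.
  by apply: cvgM; [exact: cvg_cst|exact: Hcvg].
apply: (ler_cvg_to lcvg bcvg); apply: nearW => n.
have [cfn hfn] := hf_ n.
rewrite sintegral_srestr (le_trans (ler_norm _))//.
have := H1_pairing_bound d0 r1 (compact_closed (@norm_hausdorff _ _) cK) Kr N0 HN nuK cfn hfn.
rewrite -/A -/U => /le_trans; apply.
by rewrite /b ler_wpM2l ?mulr_ge0//; exact: H1normD_le.
Qed.
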